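(* For a Young diagram $\lambda\subseteq n^m$ with $p$ boxes we have the following relationship between dimensions of representations of $\operatorname{GL}_m$, $\operatorname{GL}_n$ and $\mathfrak{S}_p$: \[ \frac{ \dim(S^{\lambda} \mathbb{C}^m) \dim(S^{\lambda'}\mathbb{C}^n) }{ \dim \Lambda^p (\mathbb{C}^m \otimes \mathbb{C}^n )} = \frac{ f^\lambda f^{n^m / \lambda} }{ f^{n^m} }. \]
   Context: Let $m,n\geq 1$ be integers. $n^m$ denotes the rectangular Young diagram with $m$ rows and $n$ columns; $\lambda\subseteq n^m$ means $\lambda$ has at most $m$ rows and at most $n$ columns; $\lambda'$ is the conjugate (transposed) diagram. $S^{\lambda}\mathbb{C}^m$ denotes the irreducible polynomial representation of $\operatorname{GL}_m$ with highest weight $\lambda$ (Schur functor applied to $\mathbb{C}^m$). $\mathfrak{S}_p$ is the symmetric group on $p$ letters, and $f^{\nu}$ denotes the number of standard Young tableaux of (possibly skew) shape $\nu$, i.e. the dimension of the corresponding representation of the symmetric group; the skew diagram $n^m/\lambda$ is a $180\degree$ rotation of a Young diagram with $mn-p$ boxes, so it defines an irreducible representation of $\mathfrak{S}_{mn-p}$. By skew Howe duality, $\Lambda^p(\mathbb{C}^m\otimes \mathbb{C}^n)=\bigoplus_{\lambda}S^{\lambda}\mathbb{C}^m\otimes S^{\lambda'}\mathbb{C}^n$ as a $\operatorname{GL}_m\times\operatorname{GL}_n$-module, the sum over $\lambda\subseteq n^m$ with $p$ boxes. *)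

(* Defs.v *)
From HB Require Import structures.
From mathcomp Require Import all_boot all_order all_fingroup all_algebra.

Set Implicit Arguments.
Unset Strict Implicit.
Unset Printing Implicit Defensive.

Import GRing.Theory.
Local Open Scope ring_scope.

(** Diagrams inside the rectangle [n^m] are sets of boxes (row, column). *)

Definition young_diagram (m n : nat) (D : {set 'I_m * 'I_n}) : Prop :=
  forall x y : 'I_m * 'I_n,
    x \in D -> (y.1 <= x.1)%N -> (y.2 <= x.2)%N -> y \in D.

Definition conj_diagram (m n : nat) (D : {set 'I_m * 'I_n}) :
  {set 'I_n * 'I_m} := [set x | (x.2, x.1) \in D].

Definition rectangle (m n : nat) : {set 'I_m * 'I_n} := [set: 'I_m * 'I_n].

Definition boxes (m n : nat) (D : {set 'I_m * 'I_n}) : finType :=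
  {x : 'I_m * 'I_n | x \in D}.

(** Entries are numbered from 0; an injective filling by ['I_#|D|] is
    automatically a bijection. *)
Definition is_syt (m n : nat) (D : {set 'I_m * 'I_n})
    (T : {ffun boxes D -> 'I_#|D|}) : bool :=
  [&& injectiveb T,
      [forall x : boxes D, forall y : boxes D, ((val x).1 == (val y).1) &&
         ((val x).2 < (val y).2)%N ==> (T x < T y)%N]
    & [forall x : boxes D, forall y : boxes D, ((val x).2 == (val y).2) &&
         ((val x).1 < (val y).1)%N ==> (T x < T y)%N]].

Definition num_syt (m n : nat) (D : {set 'I_m * 'I_n}) : nat :=
  #|[set T : {ffun boxes D -> 'I_#|D|} | is_syt T]|.

(** For the vector space [V = K^I] with basis indexed by [I], the tensor power
    of [V] with factors indexed by [X]: its basis tensors are indexed by the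
    words [X -> I]. *)
Definition tensor (K : fieldType) (X I : finType) : vectType K :=
  {ffun {ffun X -> I} -> K^o}.

Definition basis_tensor (K : fieldType) (X I : finType) (w : {ffun X -> I}) :
  tensor K X I := [ffun u => (u == w)%:R].

(** Right action by place permutations:
    the factor at [x] of [word_act w g] is the factor at [g x] of [w]. *)
Definition word_act (X I : finType) (w : {ffun X -> I}) (g : {perm X}) :
  {ffun X -> I} := [ffun x => w (g x)].

Definition row_group (m n : nat) (D : {set 'I_m * 'I_n}) :
  {set {perm boxes D}} :=
  [set g : {perm boxes D} | [forall x : boxes D, (val (g x)).1 == (val x).1]].

Definition col_group (m n : nat) (D : {set 'I_m * 'I_n}) :
  {set {perm boxes D}} :=
  [set g : {perm boxes D} | [forall x : boxes D, (val (g x)).2 == (val x).2]].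

(** The image of a basis tensor under the Young symmetrizer
    [(\sum_(g in row_group D) g) (\sum_(h in col_group D) sgn(h) h)]. *)
Definition young_symmetrizer (K : fieldType) (m n : nat)
    (D : {set 'I_m * 'I_n}) (I : finType) (w : {ffun boxes D -> I}) :
  tensor K (boxes D) I :=
  \sum_(g in row_group D) \sum_(h in col_group D)
    (-1) ^+ h *: basis_tensor K (word_act (word_act w g) h).

(** The Schur functor of the diagram [D] applied to [K^I]: the image of the
    Young symmetrizer.  Indexing the tensor factors by the boxes of [D] amounts
    to numbering the boxes by a tableau. *)
Definition schur_functor (K : fieldType) (m n : nat)
    (D : {set 'I_m * 'I_n}) (I : finType) : {vspace tensor K (boxes D) I} :=
  <<codom (@young_symmetrizer K m n D I)>>%VS.

Definition antisymmetrizer (K : fieldType) (p : nat) (I : finType)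
    (w : {ffun 'I_p -> I}) : tensor K 'I_p I :=
  \sum_(g : {perm 'I_p}) (-1) ^+ g *: basis_tensor K (word_act w g).

(** The [p]-th exterior power of [K^I], as the image of the antisymmetrizer
    ([K] is meant to have characteristic 0). *)
Definition exterior_power (K : fieldType) (p : nat) (I : finType) :
  {vspace tensor K 'I_p I} :=
  <<codom (@antisymmetrizer K p I)>>%VS.

(* Main.v *)
Require Import Defs.
From mathcomp Require Import all_boot all_order all_fingroup all_algebra.
From mathcomp Require Import reals complex.
From mathcomp Require Import zify ring.

Set Implicit Arguments.
Unset Strict Implicit.
Unset Printing Implicit Defensive.

Import Order.TTheory GRing.Theory Num.Theory.
Local Open Scope ring_scope.

(** In every representation of the symmetric group of the boxes of [la], the
    Young symmetrizer [e = a b] satisfies [e^2 = k e] for one scalar [k], so its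
    rank is [tr e / k].

    On words in [N] letters, removing the corners of [la] one after the other
    gives [tr e = \prod_x (N + c(x))], where [c] is the content.

    For standard tableaux [t <> u], of any shapes, [e_t e_u = 0] as soon as
    [t] is lexicographically larger than [u].  In the regular representation,
    of dimension [p!], this shows [\sum_t rank e_t <= p!] and
    [f^(shape t) <= rank e_t]; since [\sum_la (f^la)^2 = p!], all these are
    equalities, and [tr e = p!] yields [k f^la = p!].  Hence
    [dim S^la(K^N) = f^la / p! * \prod_x (N + c(x))].

    It remains to see that [f^(n^m / la)] is proportional to
    [f^la (mn - p)! / p! * \prod_x w(x)] with [w = (m + c) (n - c)].  Both sides
    are summed in the same way over the diagrams with one more box, because
    [\sum_x w(x) f^(la + x) = (p + 1) (mn - p) f^la]: this follows by induction
    on [p] from the corner identity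
    [\sum_(x addable) w(x) - \sum_(x removable) w(x) = mn - 2p]. *)

(** * Linear extensions and standard fillings *)

(** Neither the hook length formula nor the decomposition of the group algebra into simple modules
    is used. Since conjugation negates contents, the product of the two dimensions is
    [(f^la / p!)^2] times the product of the [(m + c) (n - c)]: this is the origin of the weight
    [w]. After division by the binomial coefficient, the theorem becomes the proportionality that
    ends the overview; its constant is read off at the empty diagram. The scalar [k] is computed in
    the regular representation but used on words. It must therefore be chosen before the
    representation, which is why the symmetrizers are built from two labels on an abstract set and
    studied in all matrix representations at once. A single up-down lemma with a weight serves
    twice: the weight [w] gives the identity in the rectangle, and the weight 1 gives the sum of the
    squares of the [f^la], inside a square so large that it cuts off no addable box. *)

Lemma pairwise_rev (T : Type) (r : rel T) (s : seq T) :
  pairwise r (rev s) = pairwise (fun x y => r y x) s.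
Proof.
elim: s => //= x s IH; rewrite rev_cons -cats1 pairwise_cat IH /= andbT.
by rewrite allrel1r all_rev.
Qed.

Section LinearExtensions.
Local Open Scope nat_scope.
Variable G : finType.
Implicit Types (e : rel G) (D : {set G}) (s : seq G).

(** Only pairs in the wrong order are excluded, so [e] need not be transitive; [before] is not, and
    its closure is never formed. *)
Definition linext e s := uniq s && pairwise (fun x y => ~~ e y x) s.

(** The length is kept apart from [#|D|] so that boxes can be removed without casts; a length other
    than [#|D|] counts 0. *)
Definition num_linext e p D :=
  #|[set t : p.-tuple G | linext e t && ([set x in tval t] == D)]|.

Lemma num_linext0 e : num_linext e 0 set0 = 1.
Proof.
rewrite /num_linext (_ : [set t | _] = [set [tuple]]) ?cards1 //.
apply/setP=> t; rewrite !inE (tuple0 t) /= [_ == [tuple]]eqxx; apply/eqP/setP=> x.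
by rewrite !inE.
Qed.

Lemma num_linext_cons e p D :
  num_linext e p.+1 D =
  \sum_(x in D | [forall y in D :\ x, ~~ e y x]) num_linext e p (D :\ x).
Proof.
rewrite /num_linext -sum1dep_card.
pose h (xt : G * p.-tuple G) := cons_tuple xt.1 xt.2.
have hK : cancel h (fun t => (thead t, [tuple of behead t])).
  by case=> x t; rewrite /h theadE; congr pair; apply: val_inj.
have hK' : cancel (fun t : p.+1.-tuple G => (thead t, [tuple of behead t])) h.
  by move=> t; rewrite [t in RHS]tuple_eta; apply: val_inj.
rewrite (reindex h) /=; last by exists (fun t => (thead t, [tuple of behead t])) => t _;
  [exact: hK | exact: hK'].
rewrite -(pair_big_dep xpredT (fun x t => linext e (h (x, t)) &&
   ([set y in h (x, t)] == D)) (fun _ _ => 1)) /= [RHS]big_mkcond /=.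
apply: eq_bigr => x _; rewrite sum1dep_card.
case: ifP => [/andP[xD /forall_inP xmin]|nx].
- apply: eq_card => t; rewrite !inE /linext /=.
  apply/andP/andP=> [[/andP[/andP[xt ut] /andP[at_ pt]] /eqP sD]|[/andP[ut pt] /eqP sD]].
    split; first by rewrite ut pt.
    apply/eqP/setP=> y; rewrite -sD !inE.
    by case: eqVneq => [->|]; rewrite ?(negPf xt).
  have yt y : (y \in t) = (y \in D :\ x) by rewrite -sD inE.
  split; last first.
    apply/eqP/setP=> y; rewrite !inE yt !inE.
    by case: eqVneq => [->|].
  rewrite ut pt yt !inE eqxx !andbT /=.
  by apply/allP=> y; rewrite yt => /xmin.
- rewrite (_ : [set t | _] = set0) ?cards0 //; apply/setP=> t; rewrite !inE /linext /=.
  apply/negbTE/negP=> /andP[/andP[/andP[xt ut] /andP[/allP at_ pt]] /eqP sD].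
  move/negP: nx; case; rewrite -{1}sD !inE eqxx /=.
  apply/forall_inP=> y; rewrite -sD !inE; case: eqVneq => //= _.
  exact: at_.
Qed.

(** Reversal exchanges minimal first elements and maximal last ones. One recursion thus serves both
    the diagram, which loses its largest entry, and the skew shape, which loses its smallest. *)
Lemma num_linext_rev e p D :
  num_linext (fun x y => e y x) p D = num_linext e p D.
Proof.
rewrite /num_linext; pose h (t : p.-tuple G) := [tuple of rev t].
have hK : involutive h by move=> t; apply: val_inj; rewrite /= revK.
rewrite -(card_imset _ (inv_inj hK)); apply: eq_card => t.
rewrite -{1}[t]hK mem_imset ?inE; last exact: inv_inj.
rewrite /linext /= rev_uniq pairwise_rev; congr (_ && (_ == D)).
by apply/setP=> x; rewrite !inE mem_rev.
Qed.

End LinearExtensions.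

Lemma num_linext_map (G H : finType) (e : rel G) (e' : rel H) (h : G -> H) p
    (D : {set G}) :
  injective h -> (forall x y, e' (h x) (h y) = e x y) ->
  num_linext e' p (h @: D) = num_linext e p D.
Proof.
move=> hI he; rewrite /num_linext.
pose hm (t : p.-tuple G) := [tuple of map h t].
have hmI : injective hm.
  by move=> t t' /(congr1 val) /= /(inj_map hI) /val_inj.
have setm (t : seq G) : [set x in map h t] = h @: [set x in t].
  apply/setP=> y; rewrite inE; apply/mapP/imsetP=> -[x xt ->]; exists x => //.
    by rewrite inE.
  by rewrite inE in xt.
rewrite -(card_imset _ hmI); apply: eq_card => t; rewrite inE.
apply/andP/imsetP => [[/andP[ut pt] /eqP sD]|[t' + ->]].
  have tim x : x \in (t : seq H) -> x \in codom h.
    have <-: x \in [set x in t] = (x \in (t : seq H)) by rewrite inE.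
    by rewrite sD => /imsetP[y _ ->]; apply: codom_f.
  have [s sE] : exists s, t = map h s :> seq H.
    elim: (t : seq H) tim => [|x s IH] tim; first by exists [::].
    have [|s' ->] := IH.
      by move=> y ys; apply: tim; rewrite inE ys orbT.
    have /codomP[x' ->] := tim x (mem_head _ _).
    by exists (x' :: s').
  have sz : size s == p by rewrite -(size_map h) -sE size_tuple.
  exists (Tuple sz); last by apply: val_inj.
  rewrite inE /linext /=; move: ut pt sD; rewrite sE map_inj_uniq // setm => -> /=.
  rewrite pairwise_map => pt /imset_inj ->; rewrite ?eqxx ?andbT //.
  by apply: sub_pairwise pt => x y; rewrite /= he.
rewrite inE /linext => /andP[/andP[ut pt] /eqP sD].
split; last by rewrite setm sD.
rewrite map_inj_uniq // ut pairwise_map.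
by apply: sub_pairwise pt => x y; rewrite /= he.
Qed.

Definition before m n (x y : 'I_m * 'I_n) : bool :=
  ((x.1 == y.1) && (x.2 < y.2)%N) || ((x.2 == y.2) && (x.1 < y.1)%N).

Lemma num_sytE m n (D : {set 'I_m * 'I_n}) :
  num_syt D = num_linext (@before m n) #|D| D.
Proof.
rewrite /num_syt /num_linext.
have sytP (T : {ffun boxes D -> 'I_#|D|}) : reflect (injective T /\ forall x y : boxes D,
    before (val x) (val y) -> (T x < T y)%N) (is_syt T).
  apply: (iffP and3P) => [[/injectiveP iT /forallP r /forallP c]|[iT mT]].
    split=> // x y /orP[] h.
      by have /forallP/(_ y) := r x; rewrite h.
    by have /forallP/(_ y) := c x; rewrite h.
  split; first exact/injectiveP.
    apply/forallP=> x; apply/forallP=> y; apply/implyP=> h; apply: mT.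
    by rewrite /before h.
  apply/forallP=> x; apply/forallP=> y; apply/implyP=> h; apply: mT.
  by rewrite /before h orbT.
pose box x (xD : x \in D) : boxes D := exist (fun z => z \in D) x xD.
have cD : #|boxes D| = #|D| by rewrite card_sig; apply: eq_card => x; rewrite inE.
(* The sequence lists the boxes by increasing entry, so an entry is an index. The default of
   [insubd] is a dummy: for [t] in [P] the index is below [#|D|]. *)
pose toT (t : #|D|.-tuple ('I_m * 'I_n)) : {ffun boxes D -> 'I_#|D|} :=
  [ffun x => insubd (cast_ord cD (enum_rank x)) (index (val x) t)].
set P := [set t : #|D|.-tuple _ | _].
have PE t x : t \in P -> (x \in D) = (x \in tval t).
  by rewrite inE => /andP[_ /eqP/setP/(_ x) <-]; rewrite inE.
have toTE t x : t \in P -> (toT t x = index (val x) t :> nat) /\ val x \in t.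
  move=> tP; have xt : val x \in tval t by rewrite -(PE _ _ tP); case: x.
  have it : (index (val x) t < #|D|)%N by rewrite -[X in (_ < X)%N](size_tuple t) index_mem.
  by rewrite ffunE val_insubd it.
have toTI : {in P &, injective toT}.
  move=> t t' tP tP' tt'; move: (tP) (tP'); rewrite !inE.
  move=> /andP[/andP[ut _] _] /andP[/andP[ut' _] _].
  apply: eq_from_tnth => i.
  have iD : tnth t i \in D by rewrite (PE _ _ tP) mem_tnth.
  have [e1 h1] := toTE _ (box _ iD) tP.
  have [e2 h2] := toTE _ (box _ iD) tP'.
  have e : i = index (tnth t i) t' :> nat.
    by rewrite -e2 -tt' e1 /= (tnth_nth (tnth t i)) index_uniq ?size_tuple.
  by rewrite [RHS](tnth_nth (tnth t i)) e nth_index.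
rewrite -(card_in_imset toTI); apply: eq_card => T; rewrite inE.
apply/sytP/imsetP => [[iT mT]|[t tP ->]].
  have [g gK Kg] : bijective T by apply: inj_card_bij; rewrite ?card_ord ?cD.
  pose t := [tuple val (g i) | i < #|D|].
  have tE (x0 : 'I_m * 'I_n) (i : 'I_#|D|) : nth x0 t i = val (g i).
    by rewrite -[LHS](tnth_nth x0) tnth_mktuple.
  have ut : uniq t by rewrite map_inj_uniq ?enum_uniq // => i j /val_inj /(can_inj Kg).
  have tP : t \in P.
    rewrite inE /linext ut /=; apply/andP; split; last first.
      apply/eqP/setP=> x; rewrite inE; apply/mapP/idP => [[i _ ->]|xD]; first exact: valP.
      by exists (T (box x xD)); rewrite ?mem_enum // gK.
    have pe : pairwise (fun i j : 'I_#|D| => i < j)%N (enum 'I_#|D|).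
      rewrite -(pairwise_map val ltn) val_enum_ord.
      by rewrite -sorted_pairwise ?iota_ltn_sorted //; apply: ltn_trans.
    rewrite pairwise_map; apply: sub_pairwise pe => i j /= ij; apply/negP => /mT.
    by rewrite !Kg /= ltnNge ltnW.
  exists t => //; apply/ffunP=> x; apply: ord_inj.
  have [-> _] := toTE _ x tP.
  rewrite -[LHS](index_uniq (val x) _ ut) ?size_tuple //.
  by rewrite (tE _ (T x)) gK.
split.
  move=> x y /(congr1 val) /=; have [-> xt] := toTE _ x tP; have [-> yt] := toTE _ y tP.
  by move=> h; apply: val_inj; rewrite -(nth_index (val x) xt) h nth_index.
move=> x y bxy; have [-> xt] := toTE _ x tP; have [-> yt] := toTE _ y tP.
move: tP; rewrite inE => /andP[/andP[ut /(pairwiseP (val x)) pt] _].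
rewrite ltnNge leq_eqVlt; apply/negP => /orP[/eqP h|h].
  have xy : val x = val y by rewrite -(nth_index (val x) xt) -h nth_index.
  by move: bxy; rewrite /before xy !ltnn !andbF.
by have := pt _ _ _ _ h; rewrite !inE !index_mem => /(_ yt xt); rewrite !nth_index // bxy.
Qed.

(** * Young diagrams and their corners *)

Section Young.
Variables m n : nat.
Implicit Types (D : {set 'I_m * 'I_n}) (x y z : 'I_m * 'I_n).

Definition box_le x y := ((x.1 <= y.1) && (x.2 <= y.2))%N.

Definition youngb D := [forall x in D, forall y, box_le y x ==> (y \in D)].

Lemma youngP D : reflect (young_diagram D) (youngb D).
Proof.
apply: (iffP forall_inP) => [h x y xD l1 l2|h x xD].
  by have /forallP/(_ y)/implyP := h x xD; rewrite /box_le l1 l2 => ->.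
apply/forallP=> y; apply/implyP => /andP[l1 l2]; exact: h xD l1 l2.
Qed.

Lemma youngb_le D x y : youngb D -> x \in D -> box_le y x -> y \in D.
Proof. by move=> /youngP h xD /andP[]; apply: h. Qed.

Lemma youngb_set0 : youngb set0.
Proof. by apply/forall_inP=> x; rewrite inE. Qed.

Lemma youngb_setT : youngb setT.
Proof. by apply/youngP=> x y; rewrite !inE. Qed.

Lemma youngbI D D' : youngb D -> youngb D' -> youngb (D :&: D').
Proof.
move=> hD hD'; apply/youngP => x y; rewrite !inE => /andP[xD xD'] l1 l2.
have l : box_le y x by apply/andP.
by rewrite (youngb_le hD xD l) (youngb_le hD' xD' l).
Qed.

Lemma youngbU D D' : youngb D -> youngb D' -> youngb (D :|: D').
Proof.
move=> hD hD'; apply/youngP => x y; rewrite !inE => h l1 l2.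
have l : box_le y x by apply/andP.
by case/orP: h => h; [rewrite (youngb_le hD h l)|rewrite (youngb_le hD' h l) orbT].
Qed.

Lemma before_le x y : before x y -> box_le x y.
Proof. by case/orP=> /andP[/eqP e l]; rewrite /box_le e leqnn ltnW. Qed.

Lemma before_irr x : before x x = false.
Proof. by rewrite /before !ltnn !andbF. Qed.

(** A box [z] southeast of [x] need not be comparable to [x] under [before]; but then the box in the
    row of [x] and the column of [z] is, and it lies in [D] because [z] does. *)
Lemma max_youngb D x : youngb D -> x \in D ->
  [forall y in D :\ x, ~~ before x y] = youngb (D :\ x).
Proof.
move=> hD xD; apply/forall_inP/idP => [h|h y].
  apply/youngP=> z y; rewrite !inE => /andP[zx zD] l1 l2.
  rewrite (youngb_le hD zD) ?andbT; last by rewrite /box_le l1.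
  apply/eqP => yx; rewrite yx in l1 l2.
  have [e2|n2] := eqVneq x.2 z.2.
    have := h z; rewrite !inE zx zD => /(_ isT)/negP; apply.
    rewrite /before e2 eqxx ltnn andbF /= ltn_neqAle l1 andbT.
    apply: contraNN zx => /eqP/val_inj e1.
    by rewrite -pair_eqE /pair_eq -e2 e1 !eqxx.
  have := h (x.1, z.2); rewrite !inE -pair_eqE /pair_eq /= eqxx /= [_ == x.2]eq_sym n2.
  rewrite (youngb_le hD zD) => [|]; last by rewrite /box_le /= l1 leqnn.
  by move=> /(_ isT); rewrite /before /= eqxx ltn_neqAle l2 n2.
move=> yDx; apply/negP => /before_le /(youngb_le h yDx).
by rewrite !inE eqxx.
Qed.

(** Dual argument: the intermediate box, in the row of [x] and the column of [y], is outside [D]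
    because [y] is. *)
Lemma min_youngb D x : youngb D -> x \notin D ->
  [forall y in (~: D) :\ x, ~~ before y x] = youngb (x |: D).
Proof.
move=> hD xD; apply/forall_inP/idP => [h|h y].
  apply/youngP=> z y; rewrite !inE => /orP[/eqP -> {z}|zD] l1 l2; last first.
    by rewrite (youngb_le hD zD) ?orbT // /box_le l1.
  have [//|yx /=] := eqVneq y x; apply: contraT => yD.
  have [e2|n2] := eqVneq y.2 x.2.
    have := h y; rewrite !inE yx yD => /(_ isT)/negP; case.
    rewrite /before e2 eqxx ltnn andbF /= ltn_neqAle l1 andbT.
    apply: contraNN yx => /eqP/val_inj e1.
    by rewrite -pair_eqE /pair_eq e2 e1 !eqxx.
  have := h (x.1, y.2); rewrite !inE -pair_eqE /pair_eq /= eqxx /= n2 /=.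
  case: (boolP (_ \in D)) => [uD|_].
    by rewrite (youngb_le hD uD) // /box_le /= l1 leqnn in yD.
  by move=> /(_ isT); rewrite /before /= eqxx ltn_neqAle l2 n2.
rewrite !inE => /andP[yx yD]; apply/negP => /before_le /(youngb_le h).
by rewrite !inE eqxx (negPf yx) (negPf yD) => /(_ isT).
Qed.

Lemma num_syt0 : num_syt (set0 : {set 'I_m * 'I_n}) = 1%N.
Proof. by rewrite num_sytE cards0 num_linext0. Qed.

Lemma num_syt_rem D : youngb D -> D != set0 ->
  num_syt D = (\sum_(x in D | youngb (D :\ x)) num_syt (D :\ x))%N.
Proof.
move=> hD; rewrite -card_gt0 num_sytE; case cD: #|D| => [//|p] _.
rewrite -num_linext_rev num_linext_cons; apply: eq_big => [x|x /andP[xD _]].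
  by case: (boolP (x \in D)) => //= xD; apply: max_youngb.
rewrite num_linext_rev num_sytE; congr num_linext.
by move: cD; rewrite (cardsD1 x) xD => -[].
Qed.

Lemma num_syt_skew D : youngb D -> D != setT ->
  num_syt (~: D) =
  (\sum_(x | (x \notin D) && youngb (x |: D)) num_syt (~: (x |: D)))%N.
Proof.
move=> hD nD; have : ~: D != set0 by apply: contraNneq nD => e; rewrite -[D]setCK e setC0.
rewrite -card_gt0 num_sytE; case cD: #|~: D| => [//|p] _.
rewrite num_linext_cons; apply: eq_big => [x|x /andP[xD _]].
  by rewrite inE; case: (boolP (x \in D)) => //= xD; apply: min_youngb.
have -> : ~: D :\ x = ~: (x |: D) by apply/setP=> y; rewrite !inE negb_or.
rewrite num_sytE; congr num_linext.
have := cardsC (x |: D); have := cardsC D; rewrite cardsU1.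
move: xD; rewrite inE => xD; rewrite cD (negbTE xD) /= => <-.
by move: #|D| #|~: (x |: D)| => a b; lia.
Qed.

Lemma exists_rem D : youngb D -> D != set0 ->
  exists2 x, x \in D & youngb (D :\ x).
Proof.
move=> hD /set0Pn[x0 x0D].
pose x := [arg max_(x > x0 in D) (x.1 + x.2)%N].
have [xD xmax] : x \in D /\ forall y, y \in D -> (y.1 + y.2 <= x.1 + x.2)%N.
  by rewrite /x; case: arg_maxnP.
exists x => //; rewrite -max_youngb //; apply/forall_inP=> y; rewrite !inE => /andP[_ yD].
apply/negP=> /orP[]/andP[/eqP e l]; have := xmax _ yD;
  by rewrite e ?leq_add2l ?leq_add2r leqNgt l.
Qed.

Lemma num_syt_gt0 D : youngb D -> (0 < num_syt D)%N.
Proof.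
elim: {D}_.+1 {-2}D (ltnSn #|D|) => // N IH D cD hD.
have [->|nD] := eqVneq D set0; first by rewrite num_syt0.
have [x xD hx] := exists_rem hD nD.
rewrite num_syt_rem // (bigD1 x) ?xD //= ltn_addr // IH //.
by move: cD; rewrite (cardsD1 x) xD; lia.
Qed.

End Young.

(** * Sums over addable and removable corners *)

Definition content m n (x : 'I_m * 'I_n) : int := x.2%:Z - x.1%:Z.

Section Corners.
Variables m n : nat.
Implicit Types (D : {set 'I_m * 'I_n}) (x y z : 'I_m * 'I_n).

(** The index is a plain number so that neighbouring rows can be named without bounds; rows beyond
    the rectangle have length 0. *)
Definition row_len D (k : nat) := #|[set x in D | x.1 == k :> nat]|.

Lemma card_row (i : 'I_m) k : (k <= n)%N ->
  #|[set x : 'I_m * 'I_n | (x.1 == i) && (x.2 < k)%N]| = k.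
Proof.
move=> kn; have -> : [set x : 'I_m * 'I_n | (x.1 == i) && (x.2 < k)%N] =
    setX [set i] [set j : 'I_n | (j < k)%N].
  by apply/setP=> -[a b]; rewrite !inE.
rewrite cardsX cards1 mul1n -sum1dep_card -(big_ord_widen n (fun _ => 1%N)) //.
by rewrite sum1_card card_ord.
Qed.

Lemma mem_row_len D x : youngb D -> (x \in D) = (x.2 < row_len D x.1)%N.
Proof.
move=> hD; apply/idP/idP => [xD|].
  rewrite -[X in (X <= _)%N](@card_row x.1) //; rewrite /row_len.
  apply/subset_leq_card/subsetP => y.
  rewrite !inE => /andP[/eqP e l]; rewrite e eqxx andbT.
  by apply: (youngb_le hD xD); rewrite /box_le e leqnn.
apply: contraTT => xD; rewrite -leqNgt.
rewrite -[X in (_ <= X)%N](card_row x.1 (ltnW (ltn_ord x.2))).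
rewrite /row_len; apply/subset_leq_card/subsetP => y; rewrite !inE => /andP[yD /eqP/val_inj e].
rewrite e eqxx ltnNge; apply: contraNN xD => l.
by apply: (youngb_le hD yD); rewrite /box_le e leqnn.
Qed.

Lemma row_len_le D k : (row_len D k <= n)%N.
Proof.
have [km|km] := ltnP k m; last first.
  rewrite /row_len (_ : [set x in D | _] = set0) ?cards0 //.
  by apply/setP => x; rewrite !inE ltn_eqF ?andbF // (leq_trans (ltn_ord x.1)).
rewrite -[X in (_ <= X)%N](@card_row (Ordinal km)) //.
rewrite /row_len; apply/subset_leq_card/subsetP => y; rewrite !inE => /andP[yD /eqP e].
by rewrite -val_eqE /= e eqxx ltn_ord.
Qed.

Lemma row_len_ge D k : (m <= k)%N -> row_len D k = 0%N.
Proof.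
move=> km; rewrite /row_len (_ : [set x in D | _] = set0) ?cards0 //.
by apply/setP => x; rewrite !inE ltn_eqF ?andbF // (leq_trans (ltn_ord x.1)).
Qed.

Lemma row_len_mono D k : youngb D -> (row_len D k.+1 <= row_len D k)%N.
Proof.
move=> hD; have [km|km] := ltnP k.+1 m; last by rewrite row_len_ge.
rewrite leqNgt; apply/negP => l.
have ln : (row_len D k < n)%N by apply: leq_trans l (row_len_le _ _).
have h : (Ordinal km, Ordinal ln) \in D by rewrite mem_row_len.
suff : (Ordinal (ltnW km), Ordinal ln) \in D by rewrite mem_row_len //= ltnn.
by apply: (youngb_le hD h); rewrite /box_le /= leqnn leqnSn.
Qed.

Lemma sum_row_len D : (\sum_(i < m) row_len D i)%N = #|D|.
Proof.
rewrite -[RHS]sum1_card (partition_big (fun x => x.1) xpredT) //=.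
apply: eq_bigr => i _; rewrite sum1dep_card; apply: eq_card => x.
by rewrite !inE.
Qed.

Lemma addableE D x : youngb D ->
  (x \notin D) && youngb (x |: D) =
  (x.2 == row_len D x.1 :> nat) &&
  ((x.1 == 0%N :> nat) || (row_len D x.1 < row_len D x.1.-1)%N).
Proof.
move=> hD; rewrite mem_row_len // -leqNgt eqn_leq.
have [l1|] := leqP (row_len D x.1) x.2; last by rewrite andbF.
rewrite andbT /= -min_youngb //; last by rewrite mem_row_len // -leqNgt.
apply/forall_inP/andP => [h|[l2 up] y].
  have l2 : (x.2 <= row_len D x.1)%N.
    rewrite leqNgt; apply/negP => l.
    have := h (x.1, Ordinal (ltn_trans l (ltn_ord x.2))).
    rewrite !inE -pair_eqE /pair_eq /= eqxx -val_eqE /= ltn_eqF //= mem_row_len //= ltnn.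
    by move=> /(_ isT); rewrite /before /= eqxx l.
  split=> //; case: (posnP x.1) => [->//|x0] /=.
  apply: leq_ltn_trans l1 _.
  have pm : (x.1.-1 < m)%N by apply: leq_ltn_trans (leq_pred _) (ltn_ord _).
  apply: contraT; rewrite -leqNgt => l.
  have := h (Ordinal pm, x.2); rewrite !inE -pair_eqE /pair_eq /= eqxx andbT.
  rewrite -val_eqE /= ltn_eqF ?prednK //= mem_row_len //= -leqNgt l => /(_ isT).
  by rewrite /before /= eqxx prednK ?leqnn ?orbT.
rewrite !inE mem_row_len // -leqNgt => /andP[yx l]; apply/negP => /orP[]/andP[/eqP e l3].
  by move: l; rewrite e leqNgt (leq_trans l3).
case/orP: up => [/eqP x0|up]; first by rewrite x0 in l3.
have x0 : (0 < x.1)%N by apply: leq_trans l3.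
have pm : (x.1.-1 < m)%N by apply: leq_ltn_trans (leq_pred _) (ltn_ord _).
have h : (Ordinal pm, x.2) \in D by rewrite mem_row_len //=; apply: leq_ltn_trans up.
have := youngb_le (y := y) hD h; rewrite /box_le /= e leqnn -ltnS prednK // l3.
by move=> /(_ isT); rewrite mem_row_len // ltnNge l.
Qed.

Lemma removableE D x : youngb D ->
  (x \in D) && youngb (D :\ x) =
  (x.2.+1 == row_len D x.1) && (row_len D x.1.+1 < row_len D x.1)%N.
Proof.
move=> hD; rewrite mem_row_len // eqn_leq.
have [l1|] := ltnP x.2 (row_len D x.1) => //=.
rewrite -max_youngb //; last by rewrite mem_row_len.
apply/forall_inP/andP => [h|[l2 dn] y].
  have l2 : (row_len D x.1 <= x.2.+1)%N.
    rewrite leqNgt; apply/negP => l.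
    have ln := leq_trans l (row_len_le D x.1).
    have := h (x.1, Ordinal ln); rewrite !inE -pair_eqE /pair_eq /= eqxx -val_eqE /= gtn_eqF //=.
    by rewrite mem_row_len //= l /before /= eqxx leqnn => /(_ isT).
  split=> //; apply: leq_trans l1; rewrite ltnS leqNgt; apply/negP => l.
  have km : (x.1.+1 < m)%N by rewrite ltnNge; apply/negP => /(row_len_ge D) e; rewrite e in l.
  have := h (Ordinal km, x.2); rewrite !inE -pair_eqE /pair_eq /= eqxx andbT -val_eqE /=.
  by rewrite gtn_eqF //= mem_row_len //= l /before /= eqxx leqnn orbT => /(_ isT).
rewrite !inE => /andP[yx yD]; apply/negP => /orP[]/andP[/eqP e l3].
  by move: yD; rewrite mem_row_len // -e ltnNge (leq_trans l2).
have km : (x.1.+1 < m)%N by apply: leq_ltn_trans l3 _.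
have : (Ordinal km, x.2) \in D by apply: (youngb_le hD yD); rewrite /box_le /= l3 e leqnn.
by rewrite mem_row_len //= ltnNge -ltnS (leq_trans dn).
Qed.

(** A row has at most one corner of each kind, in column [k i], so sums over corners become sums
    over rows; the test [k i < n] drops a box beyond the rectangle. *)
Lemma sum_pair_row (b : 'I_m -> bool) (k : 'I_m -> nat) (F : 'I_m * 'I_n -> rat)
    (f : 'I_m -> nat -> rat) :
  (forall x, F x = f x.1 x.2) ->
  \sum_(x : 'I_m * 'I_n | (x.2 == k x.1 :> nat) && b x.1) F x =
  \sum_(i < m) (if (k i < n)%N && b i then f i (k i) else 0).
Proof.
move=> hF; under eq_bigr do rewrite hF.
rewrite big_mkcond -(pair_bigA _ (fun (i : 'I_m) (j : 'I_n) =>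
   if (j == k i :> nat) && b i then f i j else 0)) /=.
apply: eq_bigr => i _; case: (b i); last by rewrite andbF big1 // => j; rewrite andbF.
rewrite andbT; case: ltnP => [kn|kn].
  rewrite (bigD1 (Ordinal kn)) //= eqxx /= big1 ?addr0 // => j.
  by rewrite -val_eqE /= => /negbTE ->.
by apply: big1 => j _; rewrite andbT ltn_eqF // (leq_trans (ltn_ord j)).
Qed.

End Corners.

(** When [lam k.+1 = lam k], row [k.+1] has no addable box and row [k] no removable one; the two
    missing values of [w] are taken at the same content, so both sums may run over all rows. The
    only other missing term, for a full first row, is [w n]. *)
Lemma corner_telescope (lam : nat -> nat) (n k : nat) (w : int -> rat) :
  (forall i, lam i.+1 <= lam i)%N -> (lam 0 <= n)%N ->
  ((lam 0 < n)%N \/ w n = 0) ->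
  \sum_(i < k.+1) (if (lam i < n)%N && ((i == 0%N :> nat) || (lam i < lam i.-1)%N)
      then w ((lam i)%:Z - i%:Z) else 0)
  - \sum_(i < k) (if (lam i.+1 < lam i)%N then w ((lam i)%:Z - 1 - i%:Z) else 0)
  = \sum_(i < k.+1) w ((lam i)%:Z - i%:Z) - \sum_(i < k) w ((lam i)%:Z - 1 - i%:Z).
Proof.
move=> mono l0 h0; elim: k => [|k IH].
  rewrite !big_ord_recl !big_ord0 /= andbT.
  rewrite ?addr0 ?subr0; case: (ltnP (lam 0) n) => [//|ge].
  have e : lam 0 = n by apply/eqP; rewrite eqn_leq l0.
  by rewrite e; case: h0 => [|->//]; rewrite e ltnn.
rewrite big_ord_recr [X in _ - X]big_ord_recr [in RHS]big_ord_recr [X in _ = _ - X]big_ord_recr /=.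
rewrite !opprD !(addrACA _ _ (- _)) IH; congr (_ + _).
have l1 : (lam k <= n)%N by elim: (k) => // j; apply: leq_trans.
move: (mono k); rewrite leq_eqVlt => /orP[/eqP e|l].
  rewrite e ltnn andbF subrr; apply/esym/eqP; rewrite subr_eq0; apply/eqP; congr w.
  by rewrite -addn1 PoszD; ring.
by rewrite l (leq_trans l l1).
Qed.

Section CornerSums.
Variables m n : nat.
Implicit Types D : {set 'I_m.+1 * 'I_n}.

Definition addable_sum D (w : 'I_m.+1 * 'I_n -> rat) : rat :=
  \sum_(x | (x \notin D) && youngb (x |: D)) w x.

Definition removable_sum D (w : 'I_m.+1 * 'I_n -> rat) : rat :=
  \sum_(x in D | youngb (D :\ x)) w x.

(** The last term is the correction for an empty last row: there the sum over rows subtracts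
    [w (- m.+1)], the value at the box just below the first column, although no box is removable. *)
Lemma corner_sum D (w : int -> rat) : youngb D ->
  ((row_len D 0 < n)%N \/ w n = 0) -> 
  addable_sum D (fun x => w (content x)) - removable_sum D (fun x => w (content x)) =
  \sum_(i < m.+1) (w ((row_len D i)%:Z - i%:Z) - w ((row_len D i)%:Z - 1 - i%:Z))
  + (if row_len D m == 0%N then w (- m.+1%:Z) else 0).
Proof.
move=> hD h0; rewrite /addable_sum /removable_sum.
rewrite (eq_bigl _ _ (fun x => addableE x hD)) (eq_bigl _ _ (fun x => removableE x hD)).
rewrite (@sum_pair_row _ _ (fun i : 'I_m.+1 => 
    (i == 0%N :> nat) || (row_len D i < row_len D i.-1)%N)
  (fun i => row_len D i) _ (fun i j => w (j%:Z - i%:Z))) //.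
have rE (x : 'I_m.+1 * 'I_n) : (x.2.+1 == row_len D x.1) && (row_len D x.1.+1 < row_len D x.1)%N
   = (x.2 == (row_len D x.1).-1 :> nat) && (row_len D x.1.+1 < row_len D x.1)%N.
  by case: (row_len D x.1) => [|l] //=; rewrite !andbF.
rewrite (eq_bigl _ _ rE).
rewrite (@sum_pair_row _ _ (fun i : 'I_m.+1 => (row_len D i.+1 < row_len D i)%N)
  (fun i => (row_len D i).-1) _ (fun i j => w (j%:Z - i%:Z))) //.
have -> : \sum_(i < m.+1) (if ((row_len D i).-1 < n)%N && (row_len D i.+1 < row_len D i)%N
     then w ((row_len D i).-1%:Z - i%:Z) else 0) =
  \sum_(i < m.+1) (if (row_len D i.+1 < row_len D i)%N
     then w ((row_len D i)%:Z - 1 - i%:Z) else 0).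
  apply: eq_bigr => i _; case: (ltnP (row_len D i.+1) (row_len D i)) => l; last by rewrite andbF.
  rewrite andbT.
  have l0 := leq_ltn_trans (leq0n _) l.
  rewrite (leq_trans _ (row_len_le D i)) ?prednK //.
  congr w; have e : (row_len D i)%:Z = (row_len D i).-1%:Z + 1.
    by rewrite -{1}(prednK l0) -addn1 PoszD.
  by rewrite e; ring.
rewrite [X in _ - X = _]big_ord_recr /= opprD addrA corner_telescope //; first last.
- exact: row_len_le.
- by move=> i; apply: row_len_mono.
rewrite (row_len_ge D (leqnn m.+1)) lt0n sumrB [X in _ = _ - X + _]big_ord_recr /=.
rewrite opprD -!addrA; congr (_ + (_ + _)).
case: eqVneq => [->|_] /=; last by rewrite addr0.
have -> : 0%:Z + (- 1 - m%:Z) = - m.+1%:Z by lia.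
by rewrite oppr0 addNr.
Qed.

End CornerSums.

(** * Up-down identities for the numbers of standard tableaux *)

Lemma setU1D1C (T : finType) (D : {set T}) x y :
  x != y -> x |: (D :\ y) = (x |: D) :\ y.
Proof.
move=> xy; apply/setP=> z; rewrite !inE.
by case: (eqVneq z x) => [->|]; rewrite ?xy.
Qed.

Section WeightedUp.
Variables m n : nat.
Implicit Types D : {set 'I_m.+1 * 'I_n}.

(* [rect_weight] vanishes at the contents of the two boxes which prolong the
   first row and the first column beyond the rectangle: the boundary does not
   contribute to the corner sums. *)
Definition rect_weight (c : int) : rat := ((m.+1%:Z + c) * (n%:Z - c))%:~R.

(** As [rect_weight] is quadratic, its first difference is affine in the content, so the sum over
    rows depends on [D] only through [#|D|]. *)
Lemma corner_sum_rect D : youngb D ->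
  addable_sum D (fun x => rect_weight (content x))
  - removable_sum D (fun x => rect_weight (content x))
  = (m.+1 * n)%:R - 2 * #|D|%:R.
Proof.
move=> hD; rewrite corner_sum //; last by right; rewrite /rect_weight subrr mulr0.
have -> : rect_weight (- m.+1%:Z) = 0 by rewrite /rect_weight subrr mul0r.
rewrite if_same addr0.
have tri : \sum_(i < m.+1) 2 * (i : nat)%:R = (m.+1 * m)%:R :> rat.
  elim: (m) => [|k IH]; first by rewrite big_ord1 mulr0 muln0.
  by rewrite big_ord_recr /= IH !natrM -!natr1; ring.
have -> : (m.+1 * n)%:R - 2 * #|D|%:R = \sum_(i < m.+1)
   (n%:R - m%:R) - \sum_(i < m.+1) 2 * (row_len D i)%:R + \sum_(i < m.+1) 2 * (i : nat)%:R :> rat.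
  rewrite tri -mulr_sumr -natr_sum sum_row_len sumr_const card_ord -mulr_natl.
  by rewrite !natrM; ring.
rewrite -sumrB -big_split /=; apply: eq_bigr => i _.
rewrite /rect_weight !rmorphM /= !(rmorphD, rmorphB) /= -!pmulrn -natr1.
by ring.
Qed.

Lemma row_len_last D : youngb D -> (#|D| < m.+1)%N -> row_len D m = 0%N.
Proof.
move=> hD; apply: contraTeq; rewrite -lt0n -leqNgt -sum_row_len => l.
rewrite -[X in (X <= _)%N]card_ord -sum1_card; apply: leq_sum => i _.
have mono k : (row_len D (k + i) <= row_len D i)%N.
  by elim: k => // k; apply: leq_trans; apply: row_len_mono.
by apply: leq_trans l _; have := mono (m - i)%N; rewrite subnK // -ltnS.
Qed.

(** A diagram has one more addable box than removable ones, provided the rectangle cuts none off;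
    the bounds keep the first row from being full and the last row empty. *)
Lemma corner_count D : youngb D -> (#|D| < m.+1)%N -> (#|D| < n)%N ->
  addable_sum D (fun=> 1) - removable_sum D (fun=> 1) = 1.
Proof.
move=> hD lm ln; rewrite (@corner_sum _ _ _ (fun=> 1)) //; last first.
  left; apply: leq_ltn_trans ln; apply/subset_leq_card/subsetP=> x.
  by rewrite inE => /andP[].
by rewrite row_len_last // eqxx big1 ?add0r // => i _; rewrite subrr.
Qed.

(* As diagrams are stable under unions and intersections, adding [x] and then
   removing [y != x] amounts to removing [y] and then adding [x]. *)
Lemma sum_addable_num_syt (w : 'I_m.+1 * 'I_n -> rat) (d : nat -> rat) P :
  (forall D, youngb D -> (#|D| <= P)%N -> addable_sum D w - removable_sum D w = d #|D|) ->
  forall D, youngb D -> (#|D| <= P)%N ->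
  \sum_(x | (x \notin D) && youngb (x |: D)) w x * (num_syt (x |: D))%:R =
  (\sum_(i < #|D|.+1) d i) * (num_syt D)%:R.
Proof.
move=> hd D; have [N] := ubnP #|D|; elim: N D => // N IH D cD hD DP.
pose F (x y : 'I_m.+1 * 'I_n) := w x * (num_syt (x |: (D :\ y)))%:R.
(* In the recursion for [x |: D], removing [x] itself gives back [D]; these terms add up to
   [addable_sum D w]. *)
have eF x : (x \notin D) && youngb (x |: D) ->
    w x * (num_syt (x |: D))%:R = w x * (num_syt D)%:R +
    \sum_(y | (y != x) && ((y \in x |: D) && youngb ((x |: D) :\ y))) F x y.
  move=> /andP[xD hxD]; rewrite num_syt_rem //; last by apply/set0Pn; exists x; rewrite setU11.
  rewrite (bigD1 x) /= ?setU11 ?setU1K // natrD mulrDr; congr (_ + _).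
  rewrite natr_sum mulr_sumr; apply: eq_big => [y|y /andP[/andP[_ _] yx]].
    by rewrite andbC.
  by rewrite /F setU1D1C // eq_sym.
rewrite (eq_bigr _ eF) big_split /= -mulr_suml -[X in X * _]/(addable_sum D w).
rewrite (exchange_big_dep (fun y => (y \in D) && youngb (D :\ y))) /=; last first.
  move=> x y /andP[xD hxD] /and3P[yx yD hy].
  have yD' : y \in D by move: yD; rewrite !inE (negPf yx).
  rewrite yD' /=; have := youngbI hD hy; rewrite (_ : D :&: _ = D :\ y) //.
  apply/setP=> z; rewrite !inE; case: (boolP (z \in D)) => //=; rewrite ?andbF ?orbT ?andbT //.
(* For fixed [y], these are the terms of the induction hypothesis for [D :\ y], except the one that
   adds [y] back, which is subtracted. *)
have eG y : (y \in D) && youngb (D :\ y) ->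
   \sum_(x | ((x \notin D) && youngb (x |: D)) &&
       ((y != x) && ((y \in x |: D) && youngb ((x |: D) :\ y)))) F x y
   = (\sum_(i < #|D|) d i) * (num_syt (D :\ y))%:R - w y * (num_syt D)%:R.
  move=> /andP[yD hy]; have cDy : #|D| = #|D :\ y|.+1 by rewrite (cardsD1 y D) yD.
  have lDy : (#|D :\ y| < N)%N by rewrite -ltnS -cDy.
  rewrite cDy -(IH (D :\ y)) // ?(leq_trans _ DP) // ?cDy //.
  rewrite [in RHS](bigD1 y) /=; last by rewrite !inE eqxx /= setD1K.
  rewrite setD1K // [RHS]addrC addKr; apply: eq_bigl => x.
  have [->|xy] := eqVneq x y; first by rewrite !andbF.
  rewrite /= !inE yD orbT xy /= andbT -setU1D1C //.
  case: (boolP (x \in D)) => //= xD.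
  apply/andP/idP => [[_ //]|hxy]; split => //.
  have := youngbU hD hxy; rewrite (_ : D :|: _ = x |: D) //.
  by apply/setP=> z; rewrite !inE; case: (z \in D); rewrite ?andbF ?orbT ?orbF.
rewrite (eq_bigr _ eG) sumrB -mulr_sumr -mulr_suml -[X in _ - X * _]/(removable_sum D w).
have -> : (\sum_(i < #|D|) d i) * \sum_(y in D | youngb (D :\ y)) (num_syt (D :\ y))%:R
   = (\sum_(i < #|D|) d i) * (num_syt D)%:R.
  have [->|nD] := eqVneq D set0; first by rewrite cards0 big_ord0 !mul0r.
  by rewrite [in RHS]num_syt_rem // natr_sum.
by rewrite big_ord_recr /= -(hd _ hD DP); ring.
Qed.

End WeightedUp.

Section Consequences.
Variables m n : nat.
Implicit Types D : {set 'I_m.+1 * 'I_n}.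

Lemma num_syt_rect_up D : youngb D ->
  \sum_(x | (x \notin D) && youngb (x |: D))
     rect_weight m n (content x) * (num_syt (x |: D))%:R =
  #|D|.+1%:R * ((m.+1 * n)%:R - #|D|%:R) * (num_syt D)%:R.
Proof.
move=> hD; rewrite (@sum_addable_num_syt _ _ _ (fun p => (m.+1 * n)%:R - 2 * p%:R) #|D|) //.
  congr (_ * _); elim: #|D| => [|p IH]; first by rewrite big_ord1 /=; ring.
  by rewrite big_ord_recr /= IH -!natr1; ring.
by move=> D' hD' _; apply: corner_sum_rect.
Qed.

Lemma card_box : #|{: 'I_m.+1 * 'I_n}| = (m.+1 * n)%N.
Proof. by rewrite card_prod !card_ord. Qed.

Lemma num_syt_skewE D : youngb D ->
  (num_syt D)%:R * (\prod_(x in D) rect_weight m n (content x))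
    * (m.+1 * n - #|D|)`!%:R * (num_syt (rectangle m.+1 n))%:R
  = #|D|`!%:R * (m.+1 * n)`!%:R * (num_syt (~: D))%:R :> rat.
Proof.
pose W D := \prod_(x in D) rect_weight m n (content x).
(* The factorials are chosen so that [num_syt_rect_up] reads [g D = \sum_x g (x |: D)], the
   recursion of the skew counts. *)
pose g D := (num_syt D)%:R * W D * (m.+1 * n - #|D|)`!%:R / #|D|`!%:R : rat.
have factNZ p : p`!%:R != 0 :> rat by rewrite pnatr_eq0 -lt0n fact_gt0.
have gE : forall D, youngb D -> g D = g setT * (num_syt (~: D))%:R.
  move=> {}D; have [N] := ubnP #|~: D|; elim: N D => // N IH D cD hD.
  have [->|nD] := eqVneq D setT; first by rewrite setCT num_syt0 mulr1.
  rewrite num_syt_skew // natr_sum mulr_sumr.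
  have cDC : (#|D| + #|~: D| = m.+1 * n)%N by rewrite cardsC card_box.
  have cDC0 : (0 < #|~: D|)%N.
    by rewrite card_gt0; apply: contraNneq nD => e; rewrite -[D]setCK e setC0.
  have -> : g D = \sum_(x | (x \notin D) && youngb (x |: D)) g (x |: D).
    pose c := W D * (#|~: D|.-1)`!%:R / (#|D|.+1)`!%:R.
    transitivity (c * (#|D|.+1%:R * ((m.+1 * n)%:R - #|D|%:R) * (num_syt D)%:R)).
      rewrite /g /c factS natrM -cDC natrD addrAC subrr add0r addKn.
      rewrite -{1}(prednK cDC0) factS prednK // natrM invfM.
      by field; rewrite factNZ nat1r pnatr_eq0.
    rewrite -num_syt_rect_up // mulr_sumr; apply: eq_bigr => x /andP[xD _].
    rewrite /g /W big_setU1 //= -/(W D) cardsU1 xD add1n -cDC subnS addKn /c.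
    by field; rewrite factNZ.
  apply: eq_bigr => x /andP[xD hxD]; apply: IH => //.
  have -> : ~: (x |: D) = ~: D :\ x by apply/setP=> y; rewrite !inE negb_or.
  by move: cD; rewrite (cardsD1 x (~: D)) inE xD.
(* The case of the empty diagram gives [g setT] in terms of the tableaux of the rectangle, without
   computing the product of all weights. *)
move=> hD; have := gE _ hD; have := gE _ (youngb_set0 _ _).
rewrite setC0 /g /W big_set0 cards0 subn0 fact0 num_syt0 mulr1 divr1 mul1r => ->.
rewrite -/(W D) => e.
transitivity (#|D|`!%:R * (g D) * (num_syt (rectangle m.+1 n))%:R : rat).
  by rewrite /g; field.
rewrite [g D]e; rewrite /rectangle; ring.
Qed.

End Consequences.

(** Sum the product of the two numbers of tableaux over all pairs of a diagram and an addable box.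
    Grouped by the larger diagram this is the sum of squares for [p.+1]; grouped by the smaller one
    it is [p.+1] times the sum for [p]. *)
Lemma sum_num_syt_sqr m p : (p <= m)%N ->
  (\sum_(D : {set 'I_m.+1 * 'I_m.+1} | youngb D && (#|D| == p)) num_syt D ^ 2 = p`!)%N.
Proof.
elim: p => [|p IH] pm.
  rewrite (bigD1 set0) ?youngb_set0 ?cards0 //= num_syt0 big1 // => D.
  by rewrite cards_eq0 => /andP[/andP[_ ->]].
rewrite factS -IH 1?ltnW // big_distrr /=.
have -> : \sum_(D : {set 'I_m.+1 * 'I_m.+1} | youngb D && (#|D| == p.+1)) (num_syt D ^ 2)%N =
  (\sum_(D : {set 'I_m.+1 * 'I_m.+1} | youngb D && (#|D| == p.+1))
    \sum_(y in D | youngb (D :\ y)) num_syt D * num_syt (D :\ y))%N.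
  apply: eq_bigr => D /andP[hD /eqP cD].
  rewrite -big_distrr /= -num_syt_rem ?mulnn // -card_gt0 cD //.
have -> : \sum_(D : {set 'I_m.+1 * 'I_m.+1} | youngb D && (#|D| == p)) (p.+1 * num_syt D ^ 2)%N =
  (\sum_(D : {set 'I_m.+1 * 'I_m.+1} | youngb D && (#|D| == p))
    \sum_(x | (x \notin D) && youngb (x |: D)) num_syt (x |: D) * num_syt D)%N.
  apply: eq_bigr => D /andP[hD /eqP cD].
  rewrite -big_distrl /= -mulnn mulnA; congr (_ * _)%N.
  apply/eqP; rewrite -(@eqr_nat rat) natrM natr_sum.
  have := @sum_addable_num_syt m m.+1 (fun=> 1) (fun=> 1) p.
  move=> /(_ _ D hD); rewrite cD leqnn => h.
  rewrite -(eq_bigr _ (fun x _ => mul1r _)) h //; first by rewrite sumr_const card_ord.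
  by move=> D' hD' l; apply: corner_count => //; rewrite ltnS (leq_trans l) // ltnW.
rewrite !pair_big_dep /=.
pose h (Dx : {set 'I_m.+1 * 'I_m.+1} * ('I_m.+1 * 'I_m.+1)) := (Dx.2 |: Dx.1, Dx.2).
pose h' (Dx : {set 'I_m.+1 * 'I_m.+1} * ('I_m.+1 * 'I_m.+1)) := (Dx.1 :\ Dx.2, Dx.2).
rewrite (reindex_onto h h') /=; last first.
  by move=> [D y] /and3P[_ yD _]; rewrite /h /h' /= setD1K.
apply: eq_big => [[D x]|[D x]] /=.
  rewrite /h' /= xpair_eqE eqxx andbT setU11 /=.
  case: (boolP (x \in D)) => [xD|xD]; last first.
    by rewrite setU1K // eqxx cardsU1 xD andbT /=; 
    case: youngb; case: youngb; rewrite ?andbF ?andbT.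
  rewrite andbF; apply/negbTE; rewrite negb_and; apply/orP; right.
  by apply/eqP => /setP/(_ x); rewrite !inE eqxx xD.
by rewrite /h' /= => /andP[_ /eqP[->]].
Qed.

(** * Young symmetrizers *)

Section Stabilizers.
Variable X : finType.
Implicit Types (k : X -> nat) (g h : {perm X}).

Definition stab k := [set g : {perm X} | [forall x, k (g x) == k x]].

Lemma stabP k g : reflect (forall x, k (g x) = k x) (g \in stab k).
Proof. by rewrite inE; apply: (iffP forallP) => h x; apply/eqP. Qed.

Lemma stab_group_set k : group_set (stab k).
Proof.
apply/group_setP; split; first by apply/stabP => x; rewrite perm1.
by move=> g h /stabP hg /stabP hh; apply/stabP => x; rewrite permM hh hg.
Qed.
Canonical stab_group k := Group (stab_group_set k).

Lemma tperm_stab k x y : (tperm x y \in stab k) = (k x == k y).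
Proof.
apply/stabP/eqP => [/(_ x)|e z]; first by rewrite tpermL.
by case: tpermP => [->|->|].
Qed.

End Stabilizers.

Lemma eq_oppmx0 (K : numFieldType) m n (A : 'M[K]_(m, n)) : A = - A -> A = 0.
Proof.
move=> e; have /eqP : 2%:R *: A = 0 by rewrite scaler_nat mulr2n {1}e addNr.
by rewrite scaler_eq0 pnatr_eq0 => /eqP.
Qed.

Section VonNeumann.
Variables (X : finType) (row col : X -> nat).

(** A Young diagram whose boxes are named by [X], that is, a tableau: tableaux of different shapes
    then define symmetrizers for the same group [{perm X}]. *)
Definition young_labels :=
  (forall x y, row x = row y -> col x = col y -> x = y) /\
  (forall x i j, (i <= row x)%N -> (j <= col x)%N -> exists y, row y = i /\ col y = j).

Hypothesis hY : young_labels.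

(* If the box (row x0, col (g x0)) were missing, moving the boxes of every row
   which reaches column [j = col (g x0)] along [col \o g] and fixing the other
   rows would inject [{x | col (g x) < j}] into [{x | col x < j}] minus [x0],
   although both sets have the same cardinal. *)
Lemma box_of_col (g : {perm X}) (x0 : X) :
  (forall x y, row x = row y -> col (g x) = col (g y) -> x = y) ->
  exists y, row y = row x0 /\ col y = col (g x0).
Proof.
case: hY => inj cl hg.
case: (pickP [pred y | (row y == row x0) && (col y == col (g x0))]) =>
  [y /andP[/eqP r /eqP c]|none].
  by exists y.
pose j := col (g x0); exfalso.
pose S := [set x | (col x < j)%N]; pose S' := [set x | (col (g x) < j)%N].
have cS : #|S'| = #|S|.
  by rewrite -(card_preimset S (@perm_inj _ g)); apply: eq_card => x; rewrite !inE.
pose long x := [exists y, (row y == row x) && (j <= col y)%N].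
pose phi x := if long x then odflt x [pick y | (row y == row x) && (col y == col (g x))] else x.
have phi_row x : row (phi x) = row x.
  by rewrite /phi; case: ifP => // _; case: pickP => //= y /andP[/eqP].
have long_row x y : row x = row y -> long x = long y by move=> e; rewrite /long e.
have phi_col x : x \in S' -> long x -> col (phi x) = col (g x).
  rewrite inE /phi => xS lx; rewrite lx; case/existsP: lx => z /andP[/eqP e lz].
  case: pickP => [y /andP[_ /eqP]//|no].
  have [//|//|y [ry cy]] := cl z (row x) (col (g x)); rewrite ?e //.
    exact: leq_trans (ltnW xS) lz.
  by have := no y; rewrite /= ry cy !eqxx.
have short0 : ~~ long x0.
  apply/existsP=> -[z /andP[/eqP e lz]].
  have [||y [ry cy]] := cl z (row x0) j; rewrite ?e //.
  by have := none y; rewrite /= ry cy !eqxx.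
have x0S : x0 \in S.
  rewrite inE ltnNge; apply: contraNN short0 => l.
  by apply/existsP; exists x0; rewrite eqxx.
have phiI : {in S' &, injective phi}.
  move=> x y xS yS e; have rxy : row x = row y by rewrite -phi_row e phi_row.
  have [lx|sx] := boolP (long x); last first.
    by move: e; rewrite /phi -(long_row _ _ rxy) (negPf sx).
  by apply: hg => //; rewrite -phi_col // e phi_col // -(long_row _ _ rxy).
have : phi @: S' \subset S :\ x0.
  apply/subsetP => _ /imsetP[x xS ->]; have [lx|sx] := boolP (long x).
    rewrite !inE phi_col //; apply/andP; split; last by rewrite inE in xS.
    apply: contraNneq short0 => e; rewrite -(long_row x) //.
    by rewrite -phi_row e.
  rewrite /phi (negPf sx) !inE; apply/andP; split.
    by apply: contraTneq xS => ->; rewrite inE ltnn.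
  rewrite ltnNge; apply: contraNN sx => l.
  by apply/existsP; exists x; rewrite eqxx.
move=> /subset_leq_card; rewrite card_in_imset // cS (cardsD1 x0 S) x0S.
by rewrite ltnn.
Qed.

(** Von Neumann's lemma: [r] sends [x] to the box in the row of [x] and the column of [g x], and
    what remains of [g] preserves columns. *)
Lemma stab_factor (g : {perm X}) :
  (forall x y, row x = row y -> col (g x) = col (g y) -> x = y) ->
  exists2 r, r \in stab row & exists2 c, c \in stab col & g = (r * c)%g.
Proof.
move=> hg; have box x := box_of_col x hg.
pose f x := odflt x [pick y | (row y == row x) && (col y == col (g x))].
have fE x : row (f x) = row x /\ col (f x) = col (g x).
  rewrite /f; case: pickP => [y /andP[/eqP ? /eqP ?]//|no].
  by have [y [ry cy]] := box x; have := no y; rewrite /= ry cy !eqxx.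
have fI : injective f.
  move=> x y e; have [r1 c1] := fE x; have [r2 c2] := fE y.
  by apply: hg; rewrite -?r1 -?c1 e.
exists (perm fI); first by apply/stabP => x; rewrite permE; case: (fE x).
exists ((perm fI)^-1 * g)%g; last by rewrite mulKVg.
apply/stabP => x; rewrite permM; set y := ((perm fI)^-1)%g x.
have -> : x = perm fI y by rewrite permKV.
by rewrite permE; case: (fE y).
Qed.

Variable K : numFieldType.

(** The group algebra is not constructed: an identity in it is stated for every [rho], with scalars
    chosen before [rho]. *)
Definition perm_rep n (rho : {perm X} -> 'M[K]_n) :=
  rho 1%g = 1%:M /\ forall g h, rho (g * h)%g = rho g *m rho h.

Section Symmetrizer.
Variables (n : nat) (rho : {perm X} -> 'M[K]_n).

Definition row_sum := \sum_(g in stab row) rho g.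
Definition col_sum := \sum_(g in stab col) (-1) ^+ g *: rho g.
Definition symmetrizer := row_sum *m col_sum.

Hypothesis hrho : perm_rep rho.

Lemma row_sum_mul g : g \in stab row -> row_sum *m rho g = row_sum.
Proof.
move=> gs; rewrite /row_sum mulmx_suml [RHS](reindex_inj (mulIg g)) /=.
by apply: eq_big => h; rewrite ?groupMr // => _; case: hrho => _ ->.
Qed.

Lemma mul_col_sum g : g \in stab col -> rho g *m col_sum = (-1) ^+ g *: col_sum.
Proof.
move=> gs; rewrite /col_sum mulmx_sumr scaler_sumr [RHS](reindex_inj (mulgI g)) /=.
apply: eq_big => h; rewrite ?groupMl // => _; case: hrho => _ ->.
by rewrite -scalemxAr scalerA odd_permM signr_addb mulrA -signr_addb addbb mul1r.
Qed.

End Symmetrizer.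

Lemma sandwich (g : {perm X}) : exists l : K, forall n (rho : {perm X} -> 'M[K]_n),
  perm_rep rho -> row_sum rho *m rho g *m col_sum rho = l *: symmetrizer rho.
Proof.
have [/existsP[x /existsP[y /and3P[xy /eqP rxy /eqP cxy]]]|no] :=
  boolP [exists x, exists y, [&& x != y, row x == row y & col (g x) == col (g y)]].
  exists 0 => n rho hrho; rewrite scale0r.
  (* The row sum absorbs this transposition; moved across [g], it becomes a column transposition,
     which changes the sign of the column sum. *)
  have tr : tperm x y \in stab row by rewrite tperm_stab rxy.
  have tc : (tperm x y ^ g)%g \in stab col by rewrite tpermJ tperm_stab cxy.
  have e : row_sum rho *m rho g *m col_sum rho = - (row_sum rho *m rho g *m col_sum rho).
    rewrite -{1}(row_sum_mul hrho tr) -(mulmxA _ (rho _) (rho g)).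
    case: (hrho) => _ hM; rewrite -hM -[(_ * g)%g](mulKVg g) mulgA -mulgA -conjgE hM.
    rewrite mulmxA -[LHS]mulmxA (mul_col_sum hrho tc) tpermJ odd_tperm (inj_eq perm_inj) xy.
    by rewrite expr1 scaleN1r mulmxN.
  exact: eq_oppmx0.
have [r rs [c cs ->]] : exists2 r, r \in stab row & exists2 c, c \in stab col & g = (r * c)%g.
  apply: stab_factor => x y rxy cxy; apply/eqP; apply: contraNT no => xy.
  by apply/existsP; exists x; apply/existsP; exists y; rewrite xy rxy cxy !eqxx.
exists ((-1) ^+ c) => n rho hrho; case: (hrho) => _ ->.
by rewrite mulmxA row_sum_mul // -mulmxA mul_col_sum // -scalemxAr.
Qed.

(** In [e e = a (b a) b], expanding [b a] into permutations leaves terms [a g b], to which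
    [sandwich] applies. *)
Lemma symmetrizer_sqr : exists k : K, forall n (rho : {perm X} -> 'M[K]_n),
  perm_rep rho -> symmetrizer rho *m symmetrizer rho = k *: symmetrizer rho.
Proof.
have [l hl] := fin_all_exists sandwich.
exists (\sum_(h in stab col) \sum_(g in stab row) (-1) ^+ h * l (h * g)%g) => n rho hrho.
rewrite {1 2}/symmetrizer mulmxA -[row_sum rho *m _ *m _]mulmxA.
have -> : col_sum rho *m row_sum rho =
    \sum_(h in stab col) \sum_(g in stab row) (-1) ^+ h *: rho (h * g)%g.
  rewrite mulmx_suml; apply: eq_bigr => h _; rewrite mulmx_sumr.
  by apply: eq_bigr => g _; case: (hrho) => _ ->; rewrite scalemxAl.
rewrite [X in X *m _]mulmx_sumr mulmx_suml scaler_suml; apply: eq_bigr => h _.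
rewrite [X in X *m _]mulmx_sumr mulmx_suml scaler_suml; apply: eq_bigr => g _.
by rewrite -scalemxAr -scalemxAl -scalerA hl.
Qed.

End VonNeumann.

(** For a full rank factorization [A = C R], the hypothesis forces [R C = k], and [A] has the trace
    of [R C]. No division by [k] is involved. *)
Lemma sqr_scale_trace (K : fieldType) n (A : 'M[K]_n) k :
  A *m A = k *: A -> \tr A = k * (\rank A)%:R.
Proof.
move: (mulmx_base A) (col_base_full A) (row_base_free A).
move: (\rank A) (col_base A) (row_base A) => r C R eA /mulVpmx CV /mulmxVp RV hA.
move: (pinvmx C) (pinvmx R) CV RV => C' R' CV RV.
have RC : R *m C = k%:M.
  move/(congr1 (fun M => C' *m M *m R')): hA; rewrite -eA.
  rewrite -!mulmxA RV mulmx1 !mulmxA CV mul1mx => ->.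
  by rewrite -scalemxAr -scalemxAl mulmxA CV mul1mx RV scalemx1.
by rewrite -eA mxtrace_mulC RC mxtrace_scalar mulr_natr.
Qed.

(** * Permutation matrices and the regular representation *)

Section PermMatrix.
Variables (K : fieldType) (W : finType).
Implicit Types f g : W -> W.

Definition fun_mx f : 'M[K]_#|W| :=
  \matrix_(i, j) (enum_val j == f (enum_val i))%:R.

Lemma fun_mx_id : fun_mx id = 1%:M.
Proof. by apply/matrixP => i j; rewrite !mxE (inj_eq enum_val_inj) eq_sym. Qed.

Lemma fun_mxM f g : fun_mx f *m fun_mx g = fun_mx (g \o f).
Proof.
apply/matrixP => i j; rewrite !mxE (bigD1 (enum_rank (f (enum_val i)))) //= !mxE.
rewrite enum_rankK eqxx mul1r big1 ?addr0 // => l nl; rewrite !mxE.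
rewrite -{1}(enum_valK l) (inj_eq enum_rank_inj) in nl.
by rewrite (negPf nl) mul0r.
Qed.

Lemma fun_mx_trace f : \tr (fun_mx f) = #|[set w | f w == w]|%:R.
Proof.
rewrite /mxtrace -sum1dep_card natr_sum [RHS]big_mkcond /=.
rewrite [RHS](reindex (@enum_val W predT)) /=; last by apply: onW_bij; apply: enum_val_bij.
by apply: eq_bigr => i _; rewrite mxE eq_sym; case: eqP.
Qed.

Lemma row_fun_mx f w : row (enum_rank w) (fun_mx f) = delta_mx 0 (enum_rank (f w)).
Proof.
apply/rowP => j; rewrite !mxE enum_rankK eqxx /=.
by rewrite -{2}(enum_valK j) (inj_eq enum_rank_inj).
Qed.

Lemma fun_mx_eq f g : f =1 g -> fun_mx f = fun_mx g.
Proof. by move=> fg; apply/matrixP => i j; rewrite !mxE fg. Qed.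

End PermMatrix.

Section Regular.
Variables (X : finType) (K : numFieldType).

Definition reg_rep (g : {perm X}) := fun_mx K (fun h : {perm X} => h * g)%g.

Lemma reg_repP : perm_rep reg_rep.
Proof.
split=> [|g h]; rewrite /reg_rep.
  by rewrite -fun_mx_id; apply: fun_mx_eq => h; rewrite mulg1.
by rewrite fun_mxM; apply: fun_mx_eq => u; rewrite /= mulgA.
Qed.

Lemma reg_rep_trace g : \tr (reg_rep g) = ((g == 1%g) * #|X|`!)%:R.
Proof.
have cP : #|{: {perm X}}| = #|X|`!.
  rewrite -(cardsT X) -card_perm; apply: eq_card => h; apply/esym/subsetP => x _.
  by rewrite inE.
rewrite fun_mx_trace -cP; congr _%:R.
have [->|ng] := eqVneq.
  rewrite mul1n -cardsT; congr #|pred_of_set _|; apply/setP=> h.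
  by rewrite !inE mulg1 eqxx.
rewrite mul0n; apply/eqP; rewrite cards_eq0; apply/eqP/setP => h; rewrite !inE /=.
by rewrite -{2}[h]mulg1 (inj_eq (mulgI h)) (negPf ng).
Qed.

(** A permutation preserving both labels is the identity, so [r c = 1] only for [r = c = 1], and the
    trace of the symmetrizer is [#|X|!]. *)
Lemma reg_symmetrizer_rank (row col : X -> nat) k :
  (forall x y, row x = row y -> col x = col y -> x = y) ->
  (forall n (rho : {perm X} -> 'M[K]_n), perm_rep rho ->
    symmetrizer row col rho *m symmetrizer row col rho = k *: symmetrizer row col rho) ->
  k * (\rank (symmetrizer row col reg_rep))%:R = #|X|`!%:R.
Proof.
move=> inj /(_ _ _ reg_repP)/sqr_scale_trace <-.
rewrite /symmetrizer mulmx_suml linear_sum /= (bigD1 1%g) ?group1 //=.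
rewrite [X in _ + X]big1 ?addr0 => [|r /andP[rs r1]]; last first.
  rewrite mulmx_sumr linear_sum big1 // => c cs /=.
  rewrite -scalemxAr linearZ /=; case: reg_repP => _ <-; rewrite reg_rep_trace.
  case: eqVneq => [rc|_]; last by rewrite mul0n mulr0.
  case/eqP: r1; have e : r = (c^-1)%g by apply/eqP; rewrite eq_mulgV1 invgK rc.
  apply/permP=> x; rewrite perm1; apply: inj; first by move/stabP: rs => ->.
  by have : r \in stab col by [rewrite e groupV]; move/stabP => ->.
rewrite mulmx_sumr linear_sum /= (bigD1 1%g) ?group1 //=.
case: reg_repP => e1 _; rewrite e1 mul1mx odd_perm1 expr0 scale1r -e1 reg_rep_trace.
rewrite eqxx mul1n big1 ?addr0 // => c /andP[_ c1].
by rewrite e1 mul1mx linearZ /= reg_rep_trace (negPf c1) mul0n mulr0.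
Qed.

End Regular.

(** * Trace of the Young symmetrizer on words *)

Section FixedWords.
Variables (X I : finType).
Implicit Types (g h : {perm X}) (w : {ffun X -> I}).

Definition fix_words g := #|[set w : {ffun X -> I} | word_act w g == w]|.

Lemma word_actM w g h : word_act w (g * h)%g = word_act (word_act w h) g.
Proof. by apply/ffunP => x; rewrite !ffunE permM. Qed.

Lemma word_act1 w : word_act w 1%g = w.
Proof. by apply/ffunP => x; rewrite ffunE perm1. Qed.

Lemma word_actK g : cancel (fun w => word_act w g) (fun w => word_act w g^-1%g).
Proof. by move=> w; rewrite -word_actM mulVg word_act1. Qed.

Lemma fix_wordsC g h : fix_words (g * h)%g = fix_words (h * g)%g.
Proof.
suff le u v : (fix_words (u * v)%g <= fix_words (v * u)%g)%N by apply/eqP; rewrite eqn_leq !le.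
rewrite /fix_words -(card_imset _ (can_inj (word_actK v))).
apply/subset_leq_card/subsetP => _ /imsetP[w + ->].
by rewrite !inE => /eqP e; rewrite word_actM -(word_actM w u v) e.
Qed.

(** The transposition inserts the fixed point [y] into the cycle of [z]: the letter at [y], free
    before, must now equal the letter at [z]. *)
Lemma fix_words_tperm g y z : g y = y -> z != y ->
  (#|I| * fix_words (g * tperm z y)%g = fix_words g)%N.
Proof.
move=> gy zy; pose S := [set w : {ffun X -> I} | (word_act w g == w) && (w y == w z)].
have -> : fix_words (g * tperm z y)%g = #|S|.
  apply: eq_card => w; rewrite !inE.
  have tK : w y = w z -> forall x, w (tperm z y x) = w x.
    by move=> e x; case: tpermP => [->|->|//].
  apply/eqP/andP => [/ffunP h|[/eqP/ffunP h /eqP e]].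
    have e : w y = w z by have := h y; rewrite ffunE permM gy tpermR.
    split; last exact/eqP; apply/eqP/ffunP => x; have := h x.
    by rewrite !ffunE permM tK.
  by apply/ffunP => x; have := h x; rewrite !ffunE permM tK.
(* Overwriting the letter at [y] is a bijection from [S] times [I] onto the words fixed by [g]. *)
pose upd (wi : {ffun X -> I} * I) := [ffun x => if x == y then wi.2 else wi.1 x].
rewrite mulnC -cardsT -cardsX -(@card_in_imset _ _ upd); last first.
  move=> [w i] [w' i']; rewrite !inE /= => /andP[/andP[_ /eqP ew] _] /andP[/andP[_ /eqP ew'] _].
  move=> /ffunP h; have -> : i = i' by have := h y; rewrite !ffunE eqxx.
  congr pair; have hx x : x != y -> w x = w' x by move=> nx; have := h x; rewrite !ffunE (negPf nx).
  apply/ffunP => x; have [->|] := eqVneq x y; last exact: hx.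
  by rewrite ew ew' hx.
apply: eq_card => w; rewrite [RHS]inE; apply/imsetP/eqP => [[[w' i] ]|/ffunP h].
  rewrite !inE => /andP[/andP[/eqP/ffunP h _] _] ->; apply/ffunP => x; rewrite !ffunE /=.
  rewrite -{1}gy (inj_eq perm_inj); case: eqP => // _; have := h x; by rewrite ffunE.
exists ([ffun x => if x == y then w z else w x], w y); last first.
  by apply/ffunP => x; rewrite !ffunE /=; case: eqP => [->|].
rewrite !inE !ffunE eqxx (negPf zy) eqxx !andbT; apply/eqP/ffunP => x.
rewrite !ffunE -{1}gy (inj_eq perm_inj); case: eqP => // _; have := h x; by rewrite ffunE.
Qed.

End FixedWords.

Section StabOn.
Variable X : finType.
Implicit Types (k : X -> nat) (Y : {set X}) (g : {perm X}).

(** The row or column group of a part [Y] of the boxes, kept inside [{perm X}] so that removing a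
    box does not change the type. *)
Definition stab_on k Y := [set g in stab k | [forall x in ~: Y, g x == x]].

Lemma stab_onP k Y g :
  reflect ((forall x, k (g x) = k x) /\ forall x, x \notin Y -> g x = x) (g \in stab_on k Y).
Proof.
rewrite inE; apply: (iffP andP) => [[/stabP h1 /forall_inP h2]|[h1 h2]]; split => //.
- by move=> x xY; apply/eqP/h2; rewrite inE.
- exact/stabP.
- by apply/forall_inP => x; rewrite inE => /h2/eqP.
Qed.

Lemma stab_on_group_set k Y : group_set (stab_on k Y).
Proof.
apply/group_setP; split.
  by apply/stab_onP; split => x; rewrite perm1.
move=> g h /stab_onP[g1 g2] /stab_onP[h1 h2]; apply/stab_onP; split => x.
  by rewrite permM h1.
by move=> xY; rewrite permM g2 // h2.
Qed.
Canonical stab_on_group k Y := Group (stab_on_group_set k Y).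

Lemma stab_onT k : stab_on k setT = stab k.
Proof.
apply/setP => g; rewrite inE; case: (boolP (g \in stab k)) => //= _.
by apply/forall_inP => x; rewrite !inE.
Qed.

Lemma tperm_stab_on k Y x y : x \in Y -> y \in Y -> k x = k y ->
  tperm x y \in stab_on k Y.
Proof.
move=> xY yY e; apply/stab_onP; split => z; case: tpermP => // ->; rewrite ?xY ?yY //.
Qed.

Lemma stab_on_in k Y g x : g \in stab_on k Y -> x \in Y -> g x \in Y.
Proof.
move=> /stab_onP[_ h] xY; apply: contraT => gY; have := h _ gY => /perm_inj e.
by rewrite e xY in gY.
Qed.

Variable V : nmodType.

(** Decomposition into cosets of the stabilizer of [y]: the index [z] is the image of [y]. *)
Lemma sum_stab_on k Y y (F : {perm X} -> V) : y \in Y ->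
  \sum_(g in stab_on k Y) F g =
  \sum_(z in Y | k z == k y) \sum_(g in stab_on k (Y :\ y)) F (g * tperm z y)%g.
Proof.
move=> yY; rewrite pair_big_dep /=.
pose h (zg : X * {perm X}) := (zg.2 * tperm zg.1 y)%g.
pose h' (g : {perm X}) := (g y, g * tperm (g y) y)%g.
rewrite (reindex_onto h h') => [|g _]; last by rewrite /h /h' /= -mulgA tperm2 mulg1.
apply: eq_bigl => -[z g]; rewrite /h /h' /= xpair_eqE permM.
apply/andP/andP => [[gS /andP[/eqP gy _]]|[/andP[zY /eqP kz] gS]].
  have zY : z \in Y by rewrite -gy -permM; apply: stab_on_in gS _.
  have kz : k z = k y by rewrite -gy -permM; case/stab_onP: gS => ->.
  have gY : g y = y by apply: (@perm_inj _ (tperm z y)); rewrite gy tpermR.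
  rewrite zY kz eqxx; split=> //.
  have gS' : g \in stab_on k Y by rewrite -(groupMr _ (tperm_stab_on zY yY kz)).
  case/stab_onP: gS' => h1 h2; apply/stab_onP; split=> // x.
  by rewrite !inE negb_and negbK => /orP[/eqP ->|/h2].
have gy : g y = y by case/stab_onP: gS => _; apply; rewrite !inE eqxx.
rewrite gy tpermR eqxx -mulgA tperm2 mulg1 eqxx; split=> //.
rewrite groupMr ?tperm_stab_on //; case/stab_onP: gS => h1 h2; apply/stab_onP; split=> // x xY.
by apply: h2; rewrite !inE (negPf xY) andbF.
Qed.

Lemma sum_stab_onV k Y (F : {perm X} -> V) :
  \sum_(g in stab_on k Y) F g = \sum_(g in stab_on k Y) F g^-1%g.
Proof. by rewrite (reindex_inj invg_inj); apply: eq_bigl => g; rewrite groupV. Qed.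

Lemma sum_stab_onl k Y y (F : {perm X} -> V) : y \in Y ->
  \sum_(g in stab_on k Y) F g =
  \sum_(z in Y | k z == k y) \sum_(g in stab_on k (Y :\ y)) F (tperm z y * g)%g.
Proof.
move=> yY; rewrite sum_stab_onV (sum_stab_on _ _ yY); apply: eq_bigr => z _.
by rewrite sum_stab_onV; apply: eq_bigr => g _; rewrite invMg invgK tpermV.
Qed.

End StabOn.

Lemma eq_opp0 (K : numDomainType) (x : K) : x = - x -> x = 0.
Proof. by move=> e; apply/eqP; rewrite -eqNr -e. Qed.

Section ContentTrace.
Variables (X : finType) (row col : X -> nat) (I : finType) (K : numFieldType).
Hypothesis inj : forall x y, row x = row y -> col x = col y -> x = y.
Hypothesis I_gt0 : (0 < #|I|)%N.
Implicit Types (Y : {set X}).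

Definition content_trace Y : K :=
  \sum_(r in stab_on row Y) \sum_(c in stab_on col Y) (-1) ^+ c * (fix_words I (r * c)%g)%:R.

Definition young_on Y := forall x i j, x \in Y -> (i <= row x)%N -> (j <= col x)%N ->
  exists y, [/\ y \in Y, row y = i & col y = j].

Lemma corner_exists Y : young_on Y -> Y != set0 ->
  exists y, [/\ y \in Y, young_on (Y :\ y),
    forall z, z \in Y -> row z = row y -> z != y -> (col z < col y)%N &
    forall z, z \in Y -> col z = col y -> z != y -> (row z < row y)%N].
Proof.
move=> hY /set0Pn[x0 x0Y]; pose y := [arg max_(x > x0 in Y) (row x + col x)%N].
have [yY ymax] : y \in Y /\ forall z, z \in Y -> (row z + col z <= row y + col y)%N.
  by rewrite /y; case: arg_maxnP.
exists y; split=> //.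
- move=> x i j; rewrite !inE => /andP[xy xY] li lj.
  have [z [zY rz cz]] := hY x i j xY li lj; exists z; split=> //.
  rewrite !inE zY andbT; apply: contraNneq xy => zy; rewrite zy in rz cz.
  by have := ymax _ xY; move=> l; apply/eqP/inj; lia.
- move=> z zY e zy; have := ymax _ zY; rewrite e leq_add2l leq_eqVlt => /orP[/eqP e'|//].
  by case/eqP: zy; apply: inj.
- move=> z zY e zy; have := ymax _ zY; rewrite e leq_add2r leq_eqVlt => /orP[/eqP e'|//].
  by case/eqP: zy; apply: inj.
Qed.

Section Corner.
Variables (Y : {set X}) (y : X).
Hypotheses (yY : y \in Y) (hY : young_on Y).
Hypothesis row_max : forall z, z \in Y -> row z = row y -> z != y -> (col z < col y)%N.
Hypothesis col_max : forall z, z \in Y -> col z = col y -> z != y -> (row z < row y)%N.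

(** Here [z] is the image of [y] under the row permutation and [z'] its preimage under the column
    permutation, so both transpositions meet in the middle of the product. *)
Let part z z' : K :=
  \sum_(r in stab_on row (Y :\ y)) \sum_(c in stab_on col (Y :\ y))
    (-1) ^+ (tperm z' y * c)%g * (fix_words I (r * tperm z y * (tperm z' y * c))%g)%:R.

Lemma content_trace_split :
  content_trace Y = \sum_(z in Y | row z == row y) \sum_(z' in Y | col z' == col y) part z z'.
Proof.
rewrite /content_trace (sum_stab_on _ _ yY); apply: eq_bigr => z _.
rewrite [RHS]exchange_big /=; apply: eq_bigr => r _.
by rewrite (sum_stab_onl _ _ yY).
Qed.

Lemma partyy : part y y = content_trace (Y :\ y).
Proof.
by apply: eq_bigr => r _; apply: eq_bigr => c _; rewrite tperm1 mulg1 mul1g.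
Qed.

Lemma stab_on_fix k g : g \in stab_on k (Y :\ y) -> g y = y.
Proof. by case/stab_onP => _; apply; rewrite !inE eqxx. Qed.

Lemma part_row z : z \in Y -> row z = row y -> z != y ->
  #|I|%:R * part z y = content_trace (Y :\ y).
Proof.
move=> zY rz zy; rewrite mulr_sumr; apply: eq_bigr => r rs; rewrite mulr_sumr.
apply: eq_bigr => c cs; rewrite tperm1 mul1g mulrCA -natrM; congr (_ * _%:R).
rewrite fix_wordsC mulgA fix_words_tperm ?(fix_wordsC _ c r) //.
by rewrite permM (stab_on_fix cs) (stab_on_fix rs).
Qed.

Lemma part_col z : z \in Y -> col z = col y -> z != y ->
  #|I|%:R * part y z = - content_trace (Y :\ y).
Proof.
move=> zY rz zy; rewrite mulr_sumr -sumrN; apply: eq_bigr => r rs; rewrite mulr_sumr -sumrN.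
apply: eq_bigr => c cs; rewrite tperm1 mulg1 mulrCA -natrM.
rewrite fix_wordsC -mulgA fix_wordsC fix_words_tperm //; last first.
  by rewrite permM (stab_on_fix cs) (stab_on_fix rs).
by rewrite fix_wordsC odd_permM odd_tperm zy signr_addb expr1 mulN1r mulNr.
Qed.

(* Since (z y)(z' y) = (z' z)(z y), where the last factor only inserts [y] in a
   cycle, it suffices to sum over the permutations r (z' z) c; with [u] the box
   in the row of [z'] and the column of [z], the substitutions r -> r (u z') and
   c -> (u z) c exchange the terms with opposite signs. *)
Lemma part0 z z' : z \in Y -> z' \in Y -> row z = row y -> col z' = col y ->
  z != y -> z' != y -> part z z' = 0.
Proof.
move=> zY z'Y rz cz' zy z'y.
have lz := row_max zY rz zy; have lz' := col_max z'Y cz' z'y.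
have [u [uY ru cu]] : exists u, [/\ u \in Y, row u = row z' & col u = col z].
  by apply: (hY yY); rewrite // ltnW.
have uy : u != y by apply: contraTneq lz => <-; rewrite cu ltnn.
have uz : u != z by apply: contraTneq lz' => uz; rewrite -ru uz rz ltnn.
have uz' : u != z' by apply: contraTneq lz => uz'; rewrite -cu uz' cz' ltnn.
have zz' : z != z' by apply: contraTneq lz' => <-; rewrite rz ltnn.
pose S : K := \sum_(r in stab_on row (Y :\ y)) \sum_(c in stab_on col (Y :\ y))
    (-1) ^+ c * (fix_words I (r * tperm z' z * c)%g)%:R.
have eS : #|I|%:R * part z z' = - S.
  rewrite mulr_sumr -sumrN; apply: eq_bigr => r rs; rewrite mulr_sumr -sumrN.
  apply: eq_bigr => c cs; rewrite mulrCA -natrM.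
  have -> : fix_words I (r * tperm z y * (tperm z' y * c))%g =
     fix_words I (c * r * tperm z' z * tperm z y)%g.
    have tt : (tperm z y * tperm z' y = tperm z' z * tperm z y)%g.
      have <- : (tperm z' y ^ tperm z y)%g = tperm z' z.
        by rewrite tpermJ tpermR tpermD // eq_sym.
      by rewrite conjgE tpermV -!mulgA tperm2 mulg1.
    by rewrite fix_wordsC -!mulgA fix_wordsC -!mulgA tt.
  rewrite fix_words_tperm //; last first.
    by rewrite !permM (stab_on_fix cs) (stab_on_fix rs) tpermD.
  rewrite -!mulgA fix_wordsC odd_permM odd_tperm z'y signr_addb expr1 mulN1r mulNr mulgA //.
have rs : tperm u z' \in stab_on row (Y :\ y).
  by apply: tperm_stab_on; rewrite ?inE ?uy ?z'y ?uY ?z'Y.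
have cs : tperm u z \in stab_on col (Y :\ y).
  by apply: tperm_stab_on; rewrite ?inE ?uy ?zy ?uY ?zY.
have S0 : S = 0.
  apply: eq_opp0; rewrite {1}/S (reindex_inj (mulIg (tperm u z'))) /= -sumrN.
  apply: eq_big => [r|r _]; first by rewrite groupMr.
  rewrite (reindex_inj (mulgI (tperm u z))) /= -sumrN.
  apply: eq_big => [c|c _]; first by rewrite groupMl.
  rewrite odd_permM odd_tperm uz signr_addb expr1 mulN1r mulNr; congr (- (_ * _%:R)).
  congr fix_words; rewrite !mulgA; congr (_ * _)%g; rewrite -!mulgA; congr (_ * _)%g.
  have <- : (tperm u z' ^ tperm z' z)%g = tperm u z.
    by rewrite tpermJ tpermL tpermD // eq_sym.
  by rewrite -conjgC mulgA tperm2 mul1g.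
apply/eqP; have /eqP := eS; rewrite S0 oppr0 mulf_eq0 pnatr_eq0.
by rewrite eqn0Ngt I_gt0.
Qed.

End Corner.

(** Stated for two arbitrary labels: it counts the boxes left of a corner and, with the labels
    exchanged, those above it. *)
Lemma card_arm Y y (k1 k2 : X -> nat) :
  (forall x z, k1 x = k1 z -> k2 x = k2 z -> x = z) ->
  (forall j, (j < k2 y)%N -> exists z, [/\ z \in Y, k1 z = k1 y & k2 z = j]) ->
  (forall z, z \in Y -> k1 z = k1 y -> z != y -> (k2 z < k2 y)%N) ->
  #|[set z in Y | (k1 z == k1 y) && (z != y)]| = k2 y.
Proof.
move=> kI kex kmax.
pose f (j : 'I_(k2 y)) := odflt y [pick z in Y | (k1 z == k1 y) && (k2 z == j)].
have fE j : [/\ f j \in Y, k1 (f j) = k1 y & k2 (f j) = j].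
  rewrite /f; case: pickP => [z /and3P[? /eqP ? /eqP ?]//|no].
  have [z [zY e1 e2]] := kex j (ltn_ord j).
  by have := no z; rewrite zY e1 e2 !eqxx.
have fI : injective f.
  by move=> i j e; apply: ord_inj; have [_ _ <-] := fE i; have [_ _ <-] := fE j; rewrite e.
rewrite -[RHS]card_ord -(card_imset predT fI); apply: eq_card => z; rewrite inE.
apply/and3P/imsetP => [[zY /eqP e zy]|[j _ ->]].
  have l := kmax z zY e zy; exists (Ordinal l) => //.
  by have [_ e1 e2] := fE (Ordinal l); apply: kI; rewrite ?e1 ?e2.
have [-> -> e] := fE j; split=> //; apply/eqP => ey; rewrite ey in e.
by have := ltn_ord j; rewrite -e ltnn.
Qed.

Theorem content_traceE Y : young_on Y ->
  content_trace Y = #|I|%:R ^+ #|~: Y| *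
    \prod_(x in Y) (#|I|%:R + (col x)%:R - (row x)%:R).
Proof.
have [N] := ubnP #|Y|; elim: N Y => // N IH Y cY hY.
have [->|nY] := eqVneq Y set0.
  rewrite /content_trace big_set0 mulr1 setC0.
  have st k : stab_on k (set0 : {set X}) = [set 1%g].
    apply/setP => g; rewrite in_set1.
    apply/stab_onP/eqP => [[_ h]|->]; last by split=> x; rewrite perm1.
    by apply/permP => x; rewrite perm1 h ?inE.
  rewrite !st !big_set1 odd_perm1 expr0 mul1r mulg1 -natrX; congr _%:R.
  rewrite cardsT -card_ffun -cardsT; apply: eq_card => w; rewrite !inE.
  by rewrite word_act1 eqxx.
have [y [yY hY' rmax cmax]] := corner_exists hY nY.
have IH' := IH (Y :\ y) _ hY'; move: IH'; rewrite (cardsD1 y) yY in cY; move=> /(_ cY) IH'.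
have I0 : #|I|%:R != 0 :> K by rewrite pnatr_eq0 -lt0n.
(* In units of the trace for [Y :\ y], the pair [(y, y)] gives [#|I|], each of the [col y] boxes to
   the left gives 1, each of the [row y] boxes above gives -1, and mixed pairs give 0. *)
have e : #|I|%:R * content_trace Y = (#|I|%:R + (col y)%:R - (row y)%:R) * content_trace (Y :\ y).
  rewrite (content_trace_split yY) (bigD1 y) /= ?yY ?eqxx // (bigD1 y) /= ?yY ?eqxx // partyy.
  rewrite mulrDr mulrDr [X in _ + X + _]mulr_sumr [X in _ + _ + X]mulr_sumr.
  rewrite [X in _ + X + _](eq_bigr (fun=> - content_trace (Y :\ y))); last first.
        by move=> z /andP[/andP[zY /eqP cz] zy]; rewrite part_col.
  rewrite [X in _ + X](eq_bigr (fun=> content_trace (Y :\ y))); last first.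
    move=> z /andP[/andP[zY /eqP rz] zy]; rewrite (bigD1 y) /= ?yY ?eqxx //.
    rewrite [X in _ * (_ + X)]big1 ?addr0 ?part_row // => z' /andP[/andP[z'Y /eqP cz'] z'y].
    by rewrite (part0 yY hY).
  have row_arm : #|[set z in Y | (row z == row y) && (z != y)]| = col y.
    apply: card_arm => // [j lj]; have [z [zY rz cz]] := hY _ _ _ yY (leqnn (row y)) (ltnW lj).
    by exists z.
  have col_arm : #|[set z in Y | (col z == col y) && (z != y)]| = row y.
    apply: card_arm => // [x z e1 e2|j lj]; first exact: inj.
    have [z [zY rz cz]] := hY _ _ _ yY (ltnW lj) (leqnn (col y)).
    by exists z.
  have armE (k : X -> nat) : (fun z => (z \in Y) && (k z == k y) && (z != y)) =1
      (fun z => z \in [set z in Y | (k z == k y) && (z != y)]).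
    by move=> z; rewrite inE andbA.
  rewrite (eq_bigl _ _ (armE col)) [X in _ + X](eq_bigl _ _ (armE row)).
  move: (content_trace _) => t.
  rewrite !sumr_const row_arm col_arm -[t *+ _]mulr_natl -[(- t) *+ _]mulr_natl; ring.
apply: (mulfI I0); rewrite e IH' (big_setD1 y yY) /=.
have -> : ~: (Y :\ y) = y |: ~: Y by apply/setP=> z; rewrite !inE negb_and negbK.
rewrite cardsU1 inE yY add1n exprS; ring.
Qed.

End ContentTrace.

(** * Ranks of the symmetrizers in the regular representation *)

(** Multiplication by [L t] kills the later [V u] and scales [V t] by a nonzero factor, so the row
    space of [V t] meets the sum of the later ones in 0. *)
Lemma rank_triangular (K : fieldType) (T : eqType) n m (V : T -> 'M[K]_(m, n))
    (L : T -> 'M[K]_n) (k : T -> K) (s : seq T) :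
  {in s, forall t, k t != 0 /\ V t *m L t = k t *: V t} ->
  pairwise (fun t u => V u *m L t == 0) s ->
  \rank (\sum_(t <- s) <<V t>>)%MS = (\sum_(t <- s) \rank (V t))%N.
Proof.
elim: s => [|t s IH] /=; first by rewrite !big_nil mxrank0.
move=> hV /andP[hs ps]; have [k0 kV] := hV t (mem_head _ _).
rewrite !big_cons -IH // => [|u us]; last by apply: hV; rewrite inE us orbT.
rewrite -(mxrank_gen (V t)).
apply: mxrank_disjoint_sum; set B := (\sum_(u <- s) _)%MS; set U := (_ :&: B)%MS.
have BL : (B <= kermx (L t))%MS.
  rewrite /B; elim: (s) hs => [|u s' IHs] /=; first by rewrite big_nil sub0mx.
  move=> /andP[/eqP hu hs]; rewrite big_cons addsmx_sub IHs // andbT.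
  by rewrite genmxE; apply/sub_kermxP.
have /sub_kermxP UL : (U <= kermx (L t))%MS by apply: submx_trans BL; apply: capmxSr.
have : (U <= <<V t>>)%MS := capmxSl _ _; rewrite genmxE => /submxP[D eU].
by move: UL; rewrite eU -mulmxA kV -scalemxAr => /eqP; rewrite scaler_eq0 (negPf k0) => /eqP.
Qed.

Section SideMul.
Variables (X : finType) (K : numFieldType).
Variables (n : nat) (rho : {perm X} -> 'M[K]_n).
Hypothesis hrho : perm_rep rho.

Lemma mul_row_sum (row : X -> nat) g :
  g \in stab row -> rho g *m row_sum row rho = row_sum row rho.
Proof.
move=> gs; rewrite /row_sum mulmx_sumr [RHS](reindex_inj (mulgI g)) /=.
by apply: eq_big => h; rewrite ?groupMl // => _; case: hrho => _ ->.
Qed.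

Lemma col_sum_mul (col : X -> nat) g : g \in stab col ->
  col_sum col rho *m rho g = (-1) ^+ g *: col_sum col rho.
Proof.
move=> gs; rewrite /col_sum mulmx_suml scaler_sumr [RHS](reindex_inj (mulIg g)) /=.
apply: eq_big => h; rewrite ?groupMr // => _; case: hrho => _ ->.
by rewrite -scalemxAl scalerA odd_permM signr_addb mulrCA -signr_addb addbb mulr1.
Qed.

(** The transposition of [x] and [y] can be inserted between the column sum of the first factor,
    which changes sign, and the row sum of the second, which does not. *)
Lemma symmetrizer_mul0 (row col row' col' : X -> nat) x y :
  x != y -> col x = col y -> row' x = row' y ->
  symmetrizer row col rho *m symmetrizer row' col' rho = 0.
Proof.
move=> xy cxy rxy; rewrite /symmetrizer mulmxA -[row_sum row rho *m _ *m _]mulmxA.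
suff -> : col_sum col rho *m row_sum row' rho = 0 by rewrite mulmx0 mul0mx.
have tc : tperm x y \in stab col by rewrite tperm_stab cxy.
have tr : tperm x y \in stab row' by rewrite tperm_stab rxy.
have e : col_sum col rho *m row_sum row' rho = - (col_sum col rho *m row_sum row' rho).
  rewrite -{1}(mul_row_sum tr) mulmxA (col_sum_mul tc) odd_tperm xy expr1 scaleN1r.
  by rewrite mulNmx.
exact: eq_oppmx0.
Qed.

End SideMul.

Lemma symmetrizer_conj (X : finType) (row col : X -> nat) (K : numFieldType) n
    (rho : {perm X} -> 'M[K]_n) (row' col' : X -> nat) (s : {perm X}) :
  perm_rep rho -> (forall x, row' x = row (s x)) -> (forall x, col' x = col (s x)) ->
  symmetrizer row' col' rho *m rho s = rho s *m symmetrizer row col rho.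
Proof.
move=> [_ hM] hr hc.
have st (k k' : X -> nat) g :
    (forall x, k' x = k (s x)) -> ((g ^ s)%g \in stab k) = (g \in stab k').
  move=> hk; apply/stabP/stabP => h x; last first.
    by rewrite -{2}(permKV s x) -hk -(h ((s^-1)%g x)) hk /conjg !permM.
  by rewrite !hk -(h (s x)) /conjg !permM permK.
have eA : row_sum row' rho *m rho s = rho s *m row_sum row rho.
  rewrite mulmx_suml mulmx_sumr [RHS](reindex_inj (conjg_inj s)) /=.
  by apply: eq_big => g; rewrite ?(st _ row') // => _; rewrite -!hM -conjgC.
have eB : col_sum col' rho *m rho s = rho s *m col_sum col rho.
  rewrite mulmx_suml mulmx_sumr [RHS](reindex_inj (conjg_inj s)) /=.
  apply: eq_big => g; rewrite ?(st _ col') // => _.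
  by rewrite -scalemxAl -scalemxAr -!hM -conjgC odd_permJ.
by rewrite /symmetrizer -mulmxA eB mulmxA eA mulmxA.
Qed.

(** * Left multiplication in the regular representation *)

Section LeftRegular.
Variables (X : finType) (K : numFieldType).

Definition left_rep (g : {perm X}) := fun_mx K (fun h : {perm X} => g^-1 * h)%g.

Lemma left_regC g h : left_rep g *m @reg_rep X K h = reg_rep K h *m left_rep g.
Proof. by rewrite !fun_mxM; apply: fun_mx_eq => u; rewrite /= mulgA. Qed.

Definition unit_row : 'rV[K]_#|{: {perm X}}| := delta_mx 0 (enum_rank (1%g : {perm X})).

Lemma unit_row_left g : unit_row *m left_rep g = unit_row *m reg_rep K g^-1%g.
Proof. by rewrite -!rowE !row_fun_mx mulg1 mul1g. Qed.

(** A matrix commuting with left multiplications is determined by its value at the identity, since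
    these reach every basis vector from it. *)
Lemma unit_row_eq0 (A : 'M[K]_#|{: {perm X}}|) :
  (forall g, left_rep g *m A = A *m left_rep g) -> unit_row *m A = 0 -> A = 0.
Proof.
move=> hA A0; apply/row_matrixP => i; rewrite row0 rowE.
have -> : delta_mx 0 i = unit_row *m left_rep (enum_val i)^-1%g.
  by rewrite -rowE row_fun_mx invgK mulg1 enum_valK.
by rewrite -mulmxA hA mulmxA A0 mul0mx.
Qed.

Variables row col : X -> nat.

Lemma left_col_sumC h :
  left_rep h *m col_sum col (@reg_rep X K) = col_sum col (@reg_rep X K) *m left_rep h.
Proof.
rewrite mulmx_suml mulmx_sumr; apply: eq_bigr => g _.
by rewrite -scalemxAl -scalemxAr left_regC.
Qed.
End LeftRegular.

Lemma seqlexi_nth (s s' : seqlexi nat) i :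
  (i < size s)%N -> (i < size s')%N -> (forall j, (j < i)%N -> nth 0%N s j = nth 0%N s' j) ->
  (s <= s')%O -> (nth 0%N s i <= nth 0%N s' i)%N.
Proof.
elim: i s s' => [|i IH] [|a s] [|b s'] //= si si' h; rewrite lexi_cons.
  by case/andP.
have e : a = b := h 0%N isT; rewrite e lexx /= => hs.
by apply: IH => // j ji; apply: (h j.+1).
Qed.

(** * Standard tableaux as sequences of boxes *)

Section Tableaux.
Variables (M p : nat).
Local Notation G := ('I_M * 'I_M)%type.
Implicit Types (t u : p.-tuple G).

Definition std t := linext (@before M M) t && youngb [set x in tval t].

Lemma std_tnth_inj t : std t -> injective (tnth t).
Proof. by move=> /andP[/andP[ut _] _]; apply/tuple_uniqP. Qed.

Lemma std_before t i j : std t -> before (tnth t i) (tnth t j) -> (i < j)%N.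
Proof.
move=> /andP[/andP[ut pt] _] b; rewrite ltnNge leq_eqVlt; apply/negP => /orP[/eqP/val_inj e|l].
  by rewrite e before_irr in b.
have := tnth t i; move=> x0; move/(pairwiseP x0): pt => /(_ j i); rewrite !inE !size_tuple.
by move=> /(_ (ltn_ord j) (ltn_ord i) l); rewrite -!tnth_nth b.
Qed.

Lemma std_below t i x : std t -> box_le x (tnth t i) -> x != tnth t i ->
  exists2 j : 'I_p, (j < i)%N & tnth t j = x.
Proof.
move=> st lx nx; have /andP[_ hY] := st.
have mem y : box_le y (tnth t i) -> exists j, tnth t j = y.
  move=> l; have : y \in [set x in tval t].
    by apply: (youngb_le hY _ l); rewrite inE mem_tnth.
  by rewrite inE => /tnthP[j ->]; exists j.
have le_of j k : box_le (tnth t j) (tnth t k) ->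
    ((tnth t j).1 == (tnth t k).1) || ((tnth t j).2 == (tnth t k).2) -> (j <= k)%N.
  move=> /andP[l1 l2] e; have [/(std_tnth_inj st)->//|ne] := eqVneq (tnth t j) (tnth t k).
  apply/ltnW/(std_before st); rewrite /before.
  rewrite -pair_eqE /pair_eq negb_and in ne.
  case/orP: e => e; rewrite e ltn_neqAle ?l1 ?l2 ?andbT /=.
    by rewrite e /= in ne; rewrite ne.
  by rewrite e orbF in ne; rewrite ltn_neqAle ne l1 orbT.
have /andP[l1 l2] := lx.
have [j ej] := mem x lx.
(* As [before] compares only within a row or a column, the comparison passes through the box in the
   row of [tnth t i] and the column of [x]. *)
have [|k ek] := mem ((tnth t i).1, x.2); first by rewrite /box_le /= leqnn.
have ki : (k <= i)%N by apply: le_of; rewrite ek /box_le /= ?leqnn ?eqxx.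
have jk : (j <= k)%N by apply: le_of; rewrite ej ek /box_le /= ?l1 ?leqnn ?eqxx ?orbT.
exists j => //; rewrite ltn_neqAle (leq_trans jk ki) andbT.
by apply: contraNneq nx => /val_inj e; rewrite -ej e.
Qed.

(** The word of row indices; its lexicographic order is the order on tableaux of the overview. *)
Definition rows t : seqlexi nat := [seq val x.1 | x <- t].

Lemma nth_rows t (i : 'I_p) : nth 0%N (rows t) i = (tnth t i).1.
Proof.
by rewrite (nth_map (tnth t i)) ?size_tuple // -tnth_nth.
Qed.

(* At the first letter [i] on which [t] and [u] differ, the box of [t] lies
   strictly higher and to the right of that of [u]; the box in the row of the
   former and in the column of the latter carries a common letter [j < i]. *)
Lemma std_diff t u : std t -> std u -> t != u -> (rows t <= rows u)%O ->
  exists i j : 'I_p, [/\ i != j, (tnth t i).1 = (tnth t j).1 & (tnth u i).2 = (tnth u j).2].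
Proof.
move=> st su tu le.
have /existsP[i0 hi0] : [exists i, tnth t i != tnth u i].
  apply: contraNT tu; rewrite negb_exists => /forallP h.
  by apply/eqP/eq_from_tnth => i; apply/eqP/negPn.
pose i := [arg min_(i < i0 | tnth t i != tnth u i) (i : nat)].
have [hi imin] : tnth t i != tnth u i /\ forall j : 'I_p, (j < i)%N -> tnth t j = tnth u j.
  rewrite /i; case: arg_minnP => // k hk kmin; split=> // j ji.
  by apply/eqP; apply: contraLR ji => /kmin; rewrite -leqNgt.
have notbelow (a b : p.-tuple G) : std a -> std b -> tnth a i != tnth b i ->
    (forall j : 'I_p, (j < i)%N -> tnth a j = tnth b j) -> ~~ box_le (tnth a i) (tnth b i).
  move=> sa sb ab h; apply/negP => l; have [j ji ej] := std_below sb l ab.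
  by move: ej; rewrite -h // => /(std_tnth_inj sa) e; rewrite e ltnn in ji.
have h1 := notbelow t u st su hi imin.
have h2 : ~~ box_le (tnth u i) (tnth t i).
  by apply: notbelow; rewrite // 1?eq_sym // => j ji; rewrite imin.
have lr : ((tnth t i).1 <= (tnth u i).1)%N.
  rewrite -!nth_rows; apply: seqlexi_nth => //; rewrite ?size_map ?size_tuple //.
  move=> j ji; have jp : (j < p)%N := ltn_trans ji (ltn_ord i).
  by rewrite !(nth_rows _ (Ordinal jp)) imin.
have lc : ((tnth u i).2 < (tnth t i).2)%N by move: h1; rewrite /box_le lr /= -ltnNge.
pose z := ((tnth t i).1, (tnth u i).2).
have [j ji ej] : exists2 j : 'I_p, (j < i)%N & tnth t j = z.
  apply: std_below => //; first by rewrite /box_le /= leqnn ltnW.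
  by rewrite -pair_eqE /pair_eq /= eqxx /= neq_ltn lc.
exists i, j; split; last by rewrite -(imin j) ?ej.
  by rewrite neq_ltn ji orbT.
by rewrite ej.
Qed.

End Tableaux.

Lemma pairwise_sort_uniq (T : eqType) (leT r : rel T) (s : seq T) :
  total leT -> transitive leT -> uniq s ->
  {in s &, forall t u, t != u -> leT t u -> r t u} -> pairwise r (sort leT s).
Proof.
move=> tot tr us hr.
have : pairwise [rel t u | leT t u && (t != u)] (sort leT s).
  rewrite pairwise_relI -uniq_pairwise sort_uniq us andbT.
  by rewrite -sorted_pairwise // sort_sorted.
apply: (@sub_in_pairwise _ (mem s)) => [t u ts us' /andP[le tu]|]; first exact: hr.
by apply/allP => t; rewrite mem_sort.
Qed.

Section Ranks.
Variables (X : finType) (K : numFieldType) (m : nat).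
Local Notation G := ('I_m.+1 * 'I_m.+1)%type.
Local Notation p := #|X|.
Implicit Types (pos : X -> G) (t u : p.-tuple G).

Definition pos_row a b (pos : X -> 'I_a * 'I_b) x : nat := (pos x).1.
Definition pos_col a b (pos : X -> 'I_a * 'I_b) x : nat := (pos x).2.

Lemma pos_young_labels a b (pos : X -> 'I_a * 'I_b) : injective pos ->
  youngb [set pos x | x : X] -> young_labels (pos_row pos) (pos_col pos).
Proof.
move=> pI hY; split=> [x y e1 e2|x i j li lj].
  apply: pI; apply/eqP; rewrite -pair_eqE /pair_eq -!val_eqE /=.
  by rewrite [(pos x).1 : nat]e1 [(pos x).2 : nat]e2 !eqxx.
have ia := leq_ltn_trans li (ltn_ord (pos x).1).
have jb := leq_ltn_trans lj (ltn_ord (pos x).2).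
have : (Ordinal ia, Ordinal jb) \in [set pos x | x : X].
  have px : pos x \in [set pos x | x : X] by apply: imset_f.
  by apply: (youngb_le hY px); rewrite /box_le li.
by move=> /imsetP[y _ e]; exists y; rewrite /pos_row /pos_col -e.
Qed.

Definition tab_pos t (x : X) := tnth t (enum_rank x).

Lemma tab_pos_inj t : std t -> injective (tab_pos t).
Proof. by move=> st x y /(std_tnth_inj st)/enum_rank_inj. Qed.

Lemma tab_pos_im t : [set tab_pos t x | x : X] = [set x in tval t].
Proof.
apply/setP=> z; rewrite inE; apply/imsetP/tnthP => [[x _ ->]|[i ->]].
  by exists (enum_rank x).
by exists (enum_val i); rewrite // /tab_pos enum_valK.
Qed.

Definition pos_symm pos := symmetrizer (pos_row pos) (pos_col pos) (@reg_rep X K).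
Definition tab_symm t := pos_symm (tab_pos t).

Lemma std_labels t : std t -> young_labels (pos_row (tab_pos t)) (pos_col (tab_pos t)).
Proof.
move=> st; apply: pos_young_labels; first exact: tab_pos_inj.
by rewrite tab_pos_im; case/andP: st.
Qed.

(** The scalar is nonzero because its product with a rank is a factorial. *)
Lemma symm_sqr (row col : X -> nat) : young_labels row col ->
  exists k : K, k != 0 /\ forall n (rho : {perm X} -> 'M[K]_n), perm_rep rho ->
    symmetrizer row col rho *m symmetrizer row col rho = k *: symmetrizer row col rho.
Proof.
move=> hY; have [k hk] := symmetrizer_sqr hY K.
exists k; split=> //; have := reg_symmetrizer_rank (proj1 hY) hk.
by apply: contra_eqN => /eqP ->; rewrite mul0r eq_sym pnatr_eq0 -lt0n fact_gt0.
Qed.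

Lemma tab_symm_mul0 (n : nat) (rho : {perm X} -> 'M[K]_n) t u :
  perm_rep rho -> std t -> std u -> t != u -> (rows u <= rows t)%O ->
  symmetrizer (pos_row (tab_pos t)) (pos_col (tab_pos t)) rho *m
  symmetrizer (pos_row (tab_pos u)) (pos_col (tab_pos u)) rho = 0.
Proof.
move=> hrho st su tu le; rewrite eq_sym in tu.
have [i [j [ij e1 e2]]] := std_diff su st tu le.
apply: (@symmetrizer_mul0 _ _ _ _ hrho _ _ _ _ (enum_val i) (enum_val j)).
- by rewrite (inj_eq enum_val_inj).
- by rewrite /pos_col /tab_pos !enum_valK e2.
- by rewrite /pos_row /tab_pos !enum_valK e1.
Qed.

Definition stds := [seq t <- enum {: p.-tuple G} | std t].

Lemma sum_tab_symm_rank : (\sum_(t | std t) \rank (tab_symm t) <= p`!)%N.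
Proof.
pose leT t u := (rows t <= rows u)%O.
pose s := sort leT stds.
have ms t : t \in s -> std t by rewrite mem_sort mem_filter => /andP[].
have hk : forall t, exists k : K, std t -> k != 0 /\ tab_symm t *m tab_symm t = k *: tab_symm t.
  move=> t; have [/std_labels/symm_sqr [k [k0 hk]]|] := boolP (std t); last by exists 0.
  by exists k => _; split=> //; apply: hk (reg_repP _ _).
have [k {}hk] := fin_all_exists hk.
have := @rank_triangular K _ _ _ tab_symm tab_symm k s.
move=> /(_ (fun t ts => hk t (ms t ts))) h.
have -> : (\sum_(t | std t) \rank (tab_symm t) = \sum_(t <- s) \rank (tab_symm t))%N.
  by rewrite (perm_big _ (permEl (perm_sort _ _))) /= big_filter big_enum_cond.
rewrite -h; last first.
  apply: pairwise_sort_uniq => [t u|t u v||t u]; first exact: le_total.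
  - exact: le_trans.
  - by rewrite filter_uniq // enum_uniq.
  rewrite !mem_filter => /andP[st _] /andP[su _] tu le; apply/eqP.
  by apply: tab_symm_mul0; rewrite // 1?eq_sym //; apply: reg_repP.
apply: leq_trans (rank_leq_col _) _; rewrite -[X in (_ <= X`!)%N]cardsT -card_perm.
apply/subset_leq_card/subsetP => g _; apply/subsetP => x _; exact: in_setT.
Qed.

End Ranks.

Section LeftCommute.
Variables (X : finType) (K : numFieldType).
Implicit Types A B : 'M[K]_#|{: {perm X}}|.

Definition left_comm A := forall g : {perm X}, left_rep K g *m A = A *m left_rep K g.

Lemma left_comm_reg h : left_comm (reg_rep K h).
Proof. by move=> g; apply: left_regC. Qed.

Lemma left_commM A B : left_comm A -> left_comm B -> left_comm (A *m B).
Proof. by move=> hA hB g; rewrite mulmxA hA -!mulmxA hB. Qed.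

Lemma left_comm_row row : left_comm (row_sum row (@reg_rep X K)).
Proof.
by move=> g; rewrite mulmx_suml mulmx_sumr; apply: eq_bigr => h _; apply: left_regC.
Qed.

Lemma left_comm_col col : left_comm (col_sum col (@reg_rep X K)).
Proof. exact: left_col_sumC. Qed.

Lemma left_comm_symm row col : left_comm (symmetrizer row col (@reg_rep X K)).
Proof. by apply: left_commM; [apply: left_comm_row|apply: left_comm_col]. Qed.

Lemma unit_row_left_row row :
  unit_row X K *m row_sum row (@left_rep X K) = unit_row X K *m row_sum row (@reg_rep X K).
Proof.
rewrite !mulmx_sumr [RHS](reindex_inj invg_inj) /=.
by apply: eq_big => g; rewrite ?groupV // => _; rewrite unit_row_left.
Qed.

Lemma unit_row_left_col col :
  unit_row X K *m col_sum col (@left_rep X K) = unit_row X K *m col_sum col (@reg_rep X K).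
Proof.
rewrite !mulmx_sumr [RHS](reindex_inj invg_inj) /=.
by apply: eq_big => g; rewrite ?groupV // => _; rewrite -!scalemxAr unit_row_left odd_permV.
Qed.

Lemma left_comm_sum A k (F : {perm X} -> K) : left_comm A ->
  A *m (\sum_(g in stab k) F g *: left_rep K g) = (\sum_(g in stab k) F g *: left_rep K g) *m A.
Proof.
move=> hA; rewrite mulmx_sumr mulmx_suml; apply: eq_bigr => g _.
by rewrite -scalemxAl -scalemxAr hA.
Qed.

Lemma left_comm_left_row A k : left_comm A ->
  A *m row_sum k (@left_rep X K) = row_sum k (@left_rep X K) *m A.
Proof.
move=> hA; have := left_comm_sum k (fun=> 1) hA.
by under eq_bigr do rewrite scale1r.
Qed.

Lemma left_comm_left_col A k : left_comm A ->
  A *m col_sum k (@left_rep X K) = col_sum k (@left_rep X K) *m A.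
Proof. exact: left_comm_sum. Qed.

(** Realizes left multiplication by the Young symmetrizer as a matrix acting on row vectors from the
    right; composition is then reversed, hence the column sum comes first. *)
Definition left_symm row col := col_sum col (@left_rep X K) *m row_sum row (@left_rep X K).

Lemma unit_row_left_symm A row col : left_comm A ->
  unit_row X K *m A *m left_symm row col =
  unit_row X K *m symmetrizer row col (@reg_rep X K) *m A.
Proof.
move=> hA; have hB := left_comm_col col; rewrite /left_symm.
move: (left_comm_left_col col hA) (left_comm_left_row row hA) (left_comm_left_row row hB).
move: (unit_row_left_col col) (unit_row_left_row row); rewrite /symmetrizer.
move: (col_sum _ _) (row_sum _ _) (col_sum _ _) (row_sum _ _) (unit_row _ _).
move=> B1 A1 B2 A2 e eB eA h1 h2 h3.
by rewrite mulmxA -(mulmxA e) h1 mulmxA -mulmxA h2 mulmxA eB -(mulmxA e) h3 mulmxA eA -(mulmxA e).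
Qed.

End LeftCommute.

Section LowerBound.
Variables (X : finType) (K : numFieldType) (m : nat).
Local Notation G := ('I_m.+1 * 'I_m.+1)%type.
Local Notation p := #|X|.
Implicit Types (pos : X -> G) (t u : p.-tuple G).

Lemma relabel (T : finType) (pos pos' : X -> T) : injective pos -> injective pos' ->
  [set pos x | x : X] = [set pos' x | x : X] -> exists s : {perm X}, forall x, pos' x = pos (s x).
Proof.
move=> pI pI' e.
have h x : exists y, pos' x = pos y.
  have : pos' x \in [set pos x | x : X] by rewrite e imset_f.
  by case/imsetP => y _; exists y.
have [f hf] := fin_all_exists h.
have fI : injective f by move=> x y e'; apply: pI'; rewrite !hf e'.
by exists (perm fI) => x; rewrite permE.
Qed.

Lemma card_std t : std t -> #|[set x in tval t]| = p.
Proof. by move=> /andP[/andP[ut _] _]; rewrite cardsE (card_uniqP ut) size_tuple. Qed.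

Lemma num_syt_std (D : {set G}) : youngb D -> #|D| = p ->
  num_syt D = #|[set t : p.-tuple G | std t && ([set x in tval t] == D)]|.
Proof.
move=> hD cD; rewrite num_sytE cD; apply: eq_card => t; rewrite !inE /std -andbA.
by case: eqP => [->|_]; rewrite ?hD ?andbF ?andbT.
Qed.

(** Each standard tableau of the shape of [t0] yields one vector in the row space of
    [tab_symm K t0]; triangularity makes these vectors independent. *)
Lemma num_syt_le_rank t0 : std t0 ->
  (num_syt [set x in tval t0] <= \rank (tab_symm K t0))%N.
Proof.
move=> st0; set D := [set x in tval t0].
have hD : youngb D by case/andP: st0.
rewrite (num_syt_std hD (card_std st0)).
pose P t := std t && ([set x in tval t] == D).
have hs : forall t, exists s : {perm X}, P t -> forall x, tab_pos t x = tab_pos t0 (s x).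
  move=> t; have [/andP[st /eqP e]|] := boolP (P t); last by exists 1%g.
  have [s hs] : exists s : {perm X}, forall x, tab_pos t x = tab_pos t0 (s x).
    by apply: relabel; rewrite ?tab_pos_im ?e //; apply: tab_pos_inj.
  by exists s.
have [sg {}hs] := fin_all_exists hs.
have hk : forall t, exists k : K, std t ->
    k != 0 /\ tab_symm K t *m tab_symm K t = k *: tab_symm K t.
  move=> t; have [/std_labels/(symm_sqr K) [k [k0 hk]]|] := boolP (std t); last by exists 0.
  by exists k => _; split=> //; apply: hk (reg_repP _ _).
have [k {}hk] := fin_all_exists hk.
(* Reading row vectors as elements of the group algebra, [V t] is [sg t] times the symmetrizer of
   [t0], that is, the symmetrizer of [t] times [sg t]; [L u] multiplies it on the left by the
   symmetrizer of [u]. *)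
pose V t := unit_row X K *m reg_rep K (sg t) *m tab_symm K t0.
pose L t := left_symm K (pos_row (tab_pos t)) (pos_col (tab_pos t)).
have VE t : P t -> V t = unit_row X K *m (tab_symm K t *m reg_rep K (sg t)).
  move=> /hs h; rewrite /V -mulmxA -(symmetrizer_conj (reg_repP X K) (s := sg t)
    (row' := pos_row (tab_pos t)) (col' := pos_col (tab_pos t))) //.
    by move=> x; rewrite /pos_row h.
  by move=> x; rewrite /pos_col h.
have VL t u : P t ->
    V t *m L u = unit_row X K *m (tab_symm K u *m tab_symm K t *m reg_rep K (sg t)).
  move=> Pt; rewrite (VE _ Pt) unit_row_left_symm ?mulmxA //.
  by apply: left_commM; [apply: left_comm_symm|apply: left_comm_reg].
have V1 t : P t -> \rank (V t) = 1%N.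
  move=> Pt; have st : std t by case/andP: Pt.
  have [k0 kE] := hk t st.
  rewrite rank_rV; suff -> : V t != 0 by [].
  apply/eqP; rewrite (VE _ Pt) => /unit_row_eq0 h.
  have : tab_symm K t *m reg_rep K (sg t) = 0.
    by apply: h; apply: left_commM; [apply: left_comm_symm|apply: left_comm_reg].
  move=> /(congr1 (fun A => A *m reg_rep K (sg t)^-1%g)); rewrite mul0mx -mulmxA.
  case: (reg_repP X K) => r1 rM; rewrite -rM mulgV r1 mulmx1 => t0'.
  have [k' [_ hk']] := symm_sqr K (std_labels st).
  have := reg_symmetrizer_rank (proj1 (std_labels st)) hk'.
  rewrite -/(pos_symm _ _) -/(tab_symm _ _) t0' mxrank0 mulr0 => /eqP.
  by rewrite eq_sym pnatr_eq0 eqn0Ngt fact_gt0.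
(* The order is decreasing, unlike in the upper bound: [V u *m L t] contains the symmetrizer of [t]
   before that of [u]. *)
pose leT t u := (rows u <= rows t)%O.
pose s := sort leT [seq t <- enum {: p.-tuple G} | P t].
have ms t : t \in s -> P t by rewrite mem_sort mem_filter => /andP[].
have -> : #|[set t : p.-tuple G | P t]| = (\sum_(t <- s) \rank (V t))%N.
  rewrite -sum1dep_card (perm_big _ (permEl (perm_sort _ _))) /= big_filter big_enum_cond.
  by apply: eq_bigr => t /V1 ->.
rewrite -(@rank_triangular K _ _ _ V L k s).
- apply: mxrankS; elim: (s) => [|t s' IH]; first by rewrite big_nil sub0mx.
  by rewrite big_cons addsmx_sub IH genmxE submxMl.
- move=> t /ms Pt; have [|k0 kE] := hk t; first by case/andP: Pt.
  by split=> //; rewrite VL // kE -scalemxAl -scalemxAr -VE.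
apply: pairwise_sort_uniq => [t u|t u v h1 h2||t u]; first exact: le_total.
- exact: le_trans h2 h1.
- by rewrite filter_uniq // enum_uniq.
rewrite !mem_filter => /andP[Pt _] /andP[Pu _] tu le; rewrite VL //.
have [st _] := andP Pt; have [su _] := andP Pu.
by rewrite [tab_symm _ t *m _](tab_symm_mul0 (reg_repP X K) st su tu le) mul0mx mulmx0.
Qed.

End LowerBound.

Section Exact.
Variables (X : finType) (K : numFieldType) (m : nat).
Local Notation G := ('I_m.+1 * 'I_m.+1)%type.
Local Notation p := #|X|.
Hypothesis pm : (p <= m)%N.

Lemma rank_tab_symm (t : p.-tuple G) : std t ->
  \rank (tab_symm K t) = num_syt [set x in tval t].
Proof.
have sumE : (\sum_(t : p.-tuple G | std t) num_syt [set x in tval t] = p`!)%N.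
  rewrite -(sum_num_syt_sqr pm).
  rewrite (partition_big (fun t : p.-tuple G => [set x in tval t])
     (fun D => youngb D && (#|D| == p))) /=; last first.
    by move=> u su; rewrite card_std // eqxx andbT; case/andP: su.
  apply: eq_bigr => D /andP[hD /eqP cD].
  rewrite (eq_bigr (fun=> num_syt D)); last by move=> u /andP[_ /eqP ->].
  by rewrite sum_nat_cond_const -num_syt_std.
have /leqif_sum : forall u : p.-tuple G, std u ->
    (num_syt [set x in tval u] <= \rank (tab_symm K u)
      ?= iff (num_syt [set x in tval u] == \rank (tab_symm K u)))%N.
  by move=> u su; split=> //; apply: num_syt_le_rank.
rewrite sumE => -[le]; rewrite eqn_leq le sum_tab_symm_rank => /esym/forall_inP h st.
by apply/esym/eqP/h.
Qed.

(** An arbitrary numbering of the boxes is conjugate to a standard one of the same shape, and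
    conjugation preserves the rank. *)
Lemma rank_pos_symm (pos : X -> G) : injective pos -> youngb [set pos x | x : X] ->
  \rank (pos_symm K pos) = num_syt [set pos x | x : X].
Proof.
move=> pI hD; have cD : #|[set pos x | x : X]| = p by rewrite card_imset.
have : (0 < num_syt [set pos x | x : X])%N by apply: num_syt_gt0.
rewrite (num_syt_std hD cD) card_gt0 => /set0Pn[t]; rewrite inE => /andP[st /eqP e].
rewrite -(num_syt_std hD cD) -e -rank_tab_symm //.
have [s hs] : exists s : {perm X}, forall x, tab_pos t x = pos (s x).
  by apply: relabel; rewrite ?tab_pos_im ?e //; apply: tab_pos_inj.
have [r1 rM] := reg_repP X K.
have := symmetrizer_conj (row' := pos_row (tab_pos t)) (col' := pos_col (tab_pos t))
  (row := pos_row pos) (col := pos_col pos) (s := s) (reg_repP X K).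
rewrite -/(pos_symm K pos) -/(pos_symm K (tab_pos t)) -/(tab_symm K t) => h.
have {}h : tab_symm K t *m reg_rep K s = reg_rep K s *m pos_symm K pos.
  by apply: h => x; rewrite /pos_row /pos_col hs.
have su : reg_rep K s \in unitmx.
  by apply: (proj1 (mulmx1_unit (B := reg_rep K s^-1%g) _)); rewrite -rM mulgV.
rewrite -(mxrankMfree (tab_symm K t) (B := reg_rep K s)) ?row_free_unit // h.
by rewrite eqmxMfull // row_full_unit.
Qed.

End Exact.

Lemma young_scalar (X : finType) (K : numFieldType) a b (pos : X -> 'I_a * 'I_b) :
  injective pos -> youngb [set pos x | x : X] ->
  exists k : K,
    (forall n (rho : {perm X} -> 'M[K]_n), perm_rep rho ->
       let S := symmetrizer (pos_row pos) (pos_col pos) rho in S *m S = k *: S) /\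
    k * (num_syt [set pos x | x : X])%:R = #|X|`!%:R.
Proof.
move=> pI hD; have hY := pos_young_labels pI hD.
have [k [_ hk]] := symm_sqr K hY; exists k; split; first exact: hk.
(* The side of a square that contains the diagram and is large enough for [sum_num_syt_sqr];
   embedding the boxes in it changes neither the labels nor the number of tableaux. *)
pose m := (a + b + #|X|)%N.
have am : (a <= m.+1)%N by rewrite /m -addnA -addnS leq_addr.
have bm : (b <= m.+1)%N by rewrite /m addnAC -addSn leq_addl.
pose h (x : 'I_a * 'I_b) := (widen_ord am x.1, widen_ord bm x.2).
have hI : injective h.
  by move=> [x1 x2] [y1 y2] [] e1 e2; congr pair; apply: ord_inj.
have eR := reg_symmetrizer_rank (proj1 hY) hk. apply: etrans eR; congr (_ * _%:R).
rewrite -[symmetrizer _ _ _]/(pos_symm K (h \o pos)).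
have imE : [set (h \o pos) x | x : X] = h @: [set pos x | x : X] by rewrite -[RHS]imset_comp.
rewrite rank_pos_symm ?leq_addl //; first 1 last.
- exact: inj_comp.
- rewrite imE; apply/youngP => _ y /imsetP[x xD ->] /= l1 l2.
  have y1 := leq_ltn_trans l1 (ltn_ord x.1); have y2 := leq_ltn_trans l2 (ltn_ord x.2).
  have -> : y = h (Ordinal y1, Ordinal y2).
    by case: y {l1 l2} y1 y2 => u v /= y1 y2; congr pair; apply: val_inj.
  by apply: imset_f; apply: (youngb_le hD xD); rewrite /box_le /= l1.
rewrite imE !num_sytE (card_imset _ hI) (num_linext_map (e := @before a b) _ _ hI) //.
Qed.

(** * Dimensions of Schur functors and exterior powers *)

Section SpanRank.
Import VectorInternalTheory.
Variables (K : fieldType) (W V : finType).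
Local Notation vT := {ffun V -> K^o}.

Lemma dim_span_tuple (U : vectType K) n (t : n.-tuple U) : \dim <<t>> = \rank (b2mx t).
Proof.
have e : span t = mx2vs (b2mx t) by rewrite unlock tvalK; case: _ / (esym _).
by rewrite /dimv e genmxE.
Qed.

Lemma dim_span_codom (f : W -> vT) :
  \dim <<codom f>> = \rank (\matrix_(i, j) f (enum_val i) (enum_val j) : 'M[K]_(#|W|, #|V|)).
Proof.
pose t := [tuple f (enum_val i) | i < #|W|].
have -> : codom f = t :> seq vT.
  apply: (@eq_from_nth _ 0) => [|i]; rewrite size_codom ?size_tuple // => iW.
  by rewrite (nth_codom _ _ (Ordinal iW)) -[RHS](tnth_nth _ _ (Ordinal iW)) tnth_mktuple.
rewrite dim_span_tuple.
(* The coordinates given by [v2r] are abstract; [B] writes the indicator functions in them and,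
   being row free, leaves the rank unchanged. *)
pose B : 'M[K]_(#|V|, _) := \matrix_j v2r ([ffun v => (v == enum_val j)%:R] : vT).
have decomp (c : 'I_#|V| -> K) :
    \sum_j c j *: ([ffun v => (v == enum_val j)%:R] : vT) = [ffun v => c (enum_rank v)].
  apply/ffunP => v; rewrite sum_ffunE ffunE (bigD1 (enum_rank v)) //= big1 => [|j jv].
    by rewrite addr0 !ffunE enum_rankK eqxx [_ *: _]mulr1.
  rewrite !ffunE; case: eqP => [e|_]; last exact: scaler0.
  by rewrite e enum_valK eqxx in jv.
have -> : b2mx t = (\matrix_(i, j) f (enum_val i) (enum_val j)) *m B.
  apply/row_matrixP => i; rewrite row_mul rowK tnth_mktuple mulmx_sum_row.
  under eq_bigr do rewrite rowK -linearZ /= !mxE.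
  rewrite -linear_sum decomp; congr v2r; apply/ffunP => v.
  by rewrite ffunE enum_rankK.
rewrite mxrankMfree //; apply: inj_row_free => u.
rewrite mulmx_sum_row; under eq_bigr do rewrite rowK -linearZ /=.
rewrite -linear_sum decomp => /(congr1 r2v); rewrite v2rK linear0.
move=> /ffunP h; apply/rowP => j; have := h (enum_val j).
by rewrite !ffunE enum_valK mxE.
Qed.

End SpanRank.

Section WordRep.
Variables (X I : finType) (K : numFieldType).

(** The inverse compensates for the reversal of products in [word_actM]. *)
Definition word_rep (g : {perm X}) := fun_mx K (fun w : {ffun X -> I} => word_act w g^-1%g).

Lemma word_repP : perm_rep word_rep.
Proof.
split=> [|g h]; rewrite /word_rep.
  by rewrite -fun_mx_id; apply: fun_mx_eq => w; rewrite invg1 word_act1.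
by rewrite fun_mxM; apply: fun_mx_eq => w; rewrite /= invMg word_actM.
Qed.

Lemma word_rep_trace g : \tr (word_rep g) = (fix_words I g)%:R.
Proof.
rewrite fun_mx_trace; congr _%:R; apply: eq_card => w; rewrite !inE.
by rewrite -[LHS](can_eq (word_actK g)) -word_actM mulgV word_act1 eq_sym.
Qed.

Variables row col : X -> nat.

Lemma word_symmetrizer_trace :
  \tr (symmetrizer row col word_rep) = content_trace row col I K setT.
Proof.
rewrite /symmetrizer mulmx_suml linear_sum /content_trace !stab_onT.
apply: eq_bigr => r _; rewrite mulmx_sumr linear_sum; apply: eq_bigr => c _ /=.
by rewrite -scalemxAr linearZ /=; case: word_repP => _ <-; rewrite word_rep_trace.
Qed.

(** The inverses in [word_rep] disappear because both groups and the sign are invariant under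
    inversion; what remains are the coefficients of [young_symmetrizer]. *)
Lemma word_symmetrizerE (w u : {ffun X -> I}) :
  symmetrizer row col word_rep (enum_rank w) (enum_rank u) =
  \sum_(g in stab row) \sum_(h in stab col)
     (-1) ^+ h * (u == word_act (word_act w g) h)%:R.
Proof.
rewrite /symmetrizer /row_sum (reindex_inj invg_inj) mulmx_suml summxE.
apply: eq_big => [g|g _]; first exact: groupV.
rewrite /col_sum (reindex_inj invg_inj) mulmx_sumr summxE.
apply: eq_big => [h|h _]; first exact: groupV.
rewrite -scalemxAr fun_mxM !mxE odd_permV !enum_rankK /= !invgK.
by [].
Qed.

Hypothesis inj : forall x y, row x = row y -> col x = col y -> x = y.
Hypothesis cl : forall x i j, (i <= row x)%N -> (j <= col x)%N -> exists y, row y = i /\ col y = j.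
Hypothesis I_gt0 : (0 < #|I|)%N.

Lemma word_symmetrizer_rank k :
  symmetrizer row col word_rep *m symmetrizer row col word_rep =
    k *: symmetrizer row col word_rep ->
  k * (\rank (symmetrizer row col word_rep))%:R =
  \prod_x (#|I|%:R + (col x)%:R - (row x)%:R).
Proof.
move=> /sqr_scale_trace <-; rewrite word_symmetrizer_trace content_traceE //.
  by rewrite setCT cards0 expr0 mul1r; apply: eq_bigl => x; rewrite inE.
move=> x i j _ li lj; have [y [ry cy]] := cl li lj.
by exists y; rewrite inE.
Qed.

End WordRep.

Lemma boxes_image m n (D : {set 'I_m * 'I_n}) : [set val x | x : boxes D] = D.
Proof.
apply/setP=> x; apply/imsetP/idP => [[y _ ->]|xD]; first exact: valP.
by exists (exist (fun z => z \in D) x xD).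
Qed.

(** The same [k] satisfies [k f = p!] in the regular representation and [k dim = \prod (N + c)] on
    words; eliminating it gives the formula. *)
Lemma dim_schur_functor (K : numFieldType) m n (D : {set 'I_m * 'I_n}) (I : finType) :
  youngb D -> (0 < #|I|)%N ->
  (\dim (schur_functor K D I))%:R * #|D|`!%:R =
  (num_syt D)%:R * \prod_(x in D) (#|I|%:R + (x.2 : nat)%:R - (x.1 : nat)%:R) :> K.
Proof.
move=> hD I0; pose pos (x : boxes D) := val x.
have pI : injective pos by apply: val_inj.
have hY : youngb [set pos x | x : boxes D] by rewrite boxes_image.
have [k [hk kE]] := young_scalar K pI hY; have [inj cl] := pos_young_labels pI hY.
have := hk _ _ (word_repP (boxes D) I K); move=> /= /(word_symmetrizer_rank inj cl I0).
have -> : \prod_x (#|I|%:R + (pos_col pos x)%:R - (pos_row pos x)%:R) =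
   \prod_(x in D) (#|I|%:R + (x.2 : nat)%:R - (x.1 : nat)%:R) :> K.
  by rewrite [RHS]big_sub.
move=> <-; rewrite boxes_image card_sig in kE.
have -> : \dim (schur_functor K D I) =
    \rank (symmetrizer (pos_row pos) (pos_col pos) (@word_rep (boxes D) I K)).
  rewrite /schur_functor dim_span_codom; congr (\rank _).
  apply/matrixP => i j; rewrite mxE -{2}(enum_valK i) -{2}(enum_valK j) word_symmetrizerE.
  rewrite /young_symmetrizer sum_ffunE; apply: eq_big => [g|g _].
    by rewrite !inE; apply: eq_forallb => x; rewrite -val_eqE.
  rewrite sum_ffunE; apply: eq_big => [h|h _].
    by rewrite !inE; apply: eq_forallb => x; rewrite -val_eqE.
  by rewrite !ffunE.
have -> : #|D|`!%:R = k * (num_syt D)%:R by rewrite kE; congr (_`!%:R); apply: eq_card.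
by rewrite mulrA mulrC [_ * k]mulrC.
Qed.

(** The antisymmetrizer is the Young symmetrizer of a single column: the row group is trivial,
    [k = p!], and the product over contents is a falling factorial. *)
Lemma dim_exterior_power (K : numFieldType) p (I : finType) :
  (0 < #|I|)%N -> (p <= #|I|)%N ->
  (\dim (exterior_power K p I) = 'C(#|I|, p))%N.
Proof.
move=> I0 pI; pose row (x : 'I_p) := x : nat; pose col (x : 'I_p) := 0%N.
have inj x y : row x = row y -> col x = col y -> x = y by move=> /val_inj.
have cl (x : 'I_p) i j : (i <= row x)%N -> (j <= col x)%N -> exists y, row y = i /\ col y = j.
  move=> li; rewrite leqn0 => /eqP ->.
  by exists (Ordinal (leq_ltn_trans li (ltn_ord x))).
have sr : stab row = [set 1%g].
  apply/setP=> g; rewrite in_set1; apply/stabP/eqP => [h|-> x]; last by rewrite perm1.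
  by apply/permP => x; rewrite perm1; apply: val_inj; apply: h.
have sc : stab col = setT by apply/setP=> g; rewrite in_setT; apply/stabP.
have hrho := word_repP 'I_p I K.
have sE : symmetrizer row col (@word_rep 'I_p I K) = col_sum col (@word_rep 'I_p I K).
  by rewrite /symmetrizer /row_sum sr big_set1; case: hrho => -> _; rewrite mul1mx.
have ss : symmetrizer row col (@word_rep 'I_p I K) *m symmetrizer row col (@word_rep 'I_p I K)
    = p`!%:R *: symmetrizer row col (@word_rep 'I_p I K).
  rewrite sE {1}/col_sum mulmx_suml.
  rewrite (eq_bigr (fun=> col_sum col (@word_rep 'I_p I K))) => [|g gs]; last first.
    by rewrite -scalemxAl mul_col_sum // scalerA -signr_addb addbb scale1r.
  by rewrite sumr_const sc scaler_nat cardsT card_Sn.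
have := word_symmetrizer_rank inj cl I0 ss.
have <- : \dim (exterior_power K p I) = \rank (symmetrizer row col (@word_rep 'I_p I K)).
  rewrite /exterior_power dim_span_codom; congr (\rank _).
  apply/matrixP => i j; rewrite mxE -{2}(enum_valK i) -{2}(enum_valK j) word_symmetrizerE.
  rewrite sr big_set1 word_act1 sc /antisymmetrizer sum_ffunE.
  by apply: eq_big => [h|h _]; rewrite ?inE // !ffunE.
have -> : \prod_x (#|I|%:R + (col x)%:R - (row x)%:R) = (#|I| ^_ p)%:R :> K.
  rewrite ffact_prod natr_prod; apply: eq_bigr => i _.
  by rewrite addr0 natrB // ltnW // (leq_trans (ltn_ord i)).
rewrite -natrM => /eqP; rewrite eqr_nat -bin_ffact mulnC => /eqP/eqP.
by rewrite eqn_pmul2r ?fact_gt0 // => /eqP.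
Qed.

(** * Conjugate diagrams and the final computation *)

Lemma conj_diagram_imset m n (D : {set 'I_m * 'I_n}) :
  conj_diagram D = [set (x.2, x.1) | x in D].
Proof.
apply/setP=> x; rewrite inE; apply/idP/imsetP => [xD|[y yD ->]].
  by exists (x.2, x.1) => //; case: x xD.
by case: y yD.
Qed.

Lemma num_syt_conj m n (D : {set 'I_m * 'I_n}) : num_syt (conj_diagram D) = num_syt D.
Proof.
pose h (x : 'I_m * 'I_n) := (x.2, x.1).
have hI : injective h by move=> [a b] [c d] [-> ->].
rewrite conj_diagram_imset -[imset _ _]/(h @: D).
rewrite !num_sytE (card_imset _ hI); apply: num_linext_map => // x y.
by rewrite /before /h /= orbC.
Qed.

Lemma youngb_conj m n (D : {set 'I_m * 'I_n}) : youngb D -> youngb (conj_diagram D).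
Proof.
move=> hD; apply/youngP=> x y; rewrite !inE => xD l1 l2.
by apply: (youngb_le hD xD); rewrite /box_le /= l1 l2.
Qed.

Theorem theorem1p1 (R : realType) (m n : nat) (hm : (1 <= m)%N)
    (hn : (1 <= n)%N) (p : nat) (la : {set 'I_m * 'I_n})
    (hla : young_diagram la) (hp : #|la| = p) :
  (\dim (schur_functor R[i] la 'I_m))%:R
    * (\dim (schur_functor R[i] (conj_diagram la) 'I_n))%:R
    / (\dim (exterior_power R[i] p ('I_m * 'I_n)%type))%:R
  = (num_syt la)%:R * (num_syt (rectangle m n :\: la))%:R
    / (num_syt (rectangle m n))%:R :> rat.
Proof.
have hD : youngb la by apply/youngP.
case: m hm la hla hp hD => // m _ la _ hp hD.
have cI : #|{: 'I_m.+1 * 'I_n}| = (m.+1 * n)%N by apply: card_box.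
have pmn : (p <= m.+1 * n)%N by rewrite -hp -cI max_card.
rewrite dim_exterior_power cI ?muln_gt0 //.
have e1 := @dim_schur_functor R[i] _ _ la 'I_m.+1 hD.
have e2 := @dim_schur_functor R[i] _ _ (conj_diagram la) 'I_n (youngb_conj hD).
rewrite !card_ord in e1 e2; have {}e1 := e1 isT; have {}e2 := e2 hn.
rewrite num_syt_conj conj_diagram_imset in e2.
have hI : injective (fun x : 'I_m.+1 * 'I_n => (x.2, x.1)) by move=> [a b] [c d] [-> ->].
rewrite card_imset // big_imset /= in e2; last by move=> ? ? _ _; apply: hI.
rewrite -conj_diagram_imset in e2.
set d1 := \dim _ in e1 *; set d2 := \dim _ in e2 *.
pose w := \prod_(x in la) ((m.+1%:Z + content x) * (n%:Z - content x)).
have eW : \prod_(x in la) rect_weight m n (content x) = w%:~R by rewrite rmorph_prod.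
(* The dimension formulas hold in [R[i]]; injectivity brings their product down to the integers,
   from where it passes to [rat], the field of the skew count. *)
have ew : d1%:Z * d2%:Z * (p`!%:Z * p`!%:Z) = (num_syt la)%:Z * (num_syt la)%:Z * w.
  apply: (@intr_inj R[i]); rewrite !rmorphM /= -!pmulrn mulrACA -{1}hp e1 -hp e2 mulrACA.
  congr (_ * _); rewrite rmorph_prod -big_split /=; apply: eq_bigr => x _.
  by rewrite /content !(rmorphM, rmorphD, rmorphN) /= -!pmulrn; ring.
have {}ew : d1%:R * d2%:R * (p`!%:R * p`!%:R) =
    (num_syt la)%:R * (num_syt la)%:R * w%:~R :> rat.
  by move/(congr1 (fun z : int => z%:~R : rat)): ew; rewrite !rmorphM /= -!pmulrn.
have e3 := num_syt_skewE hD; rewrite hp eW in e3.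
have -> : rectangle m.+1 n :\: la = ~: la by rewrite /rectangle setTD.
have nz (D : {set 'I_m.+1 * 'I_n}) : youngb D -> (num_syt D)%:R != 0 :> rat.
  by move=> h; rewrite pnatr_eq0 -lt0n num_syt_gt0.
have fnz q : q`!%:R != 0 :> rat by rewrite pnatr_eq0 -lt0n fact_gt0.
have cE : 'C(m.+1 * n, p)%:R * (p`!%:R * (m.+1 * n - p)`!%:R) = (m.+1 * n)`!%:R :> rat.
  by rewrite -!natrM bin_fact.
have cnz : 'C(m.+1 * n, p)%:R != 0 :> rat by rewrite pnatr_eq0 -lt0n bin_gt0.
have fT := nz setT (youngb_setT _ _); rewrite -[setT]/(rectangle m.+1 n) in fT.
have fl := nz la hD.
move: ew e3 cE; set f1 := (num_syt la)%:R; set f2 := (num_syt (~: la))%:R.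
set fR := (num_syt (rectangle _ _))%:R; set C := 'C(_, _)%:R.
move: (fnz p) (fnz (m.+1 * n)%N) (fnz (m.+1 * n - p)%N).
move: p`!%:R (m.+1 * n)`!%:R (m.+1 * n - p)`!%:R w%:~R d1%:R d2%:R.
move=> a b c v x y a0 b0 c0 ew e3 cE.
apply/eqP; rewrite eqr_div //; apply/eqP.
(* The factor [p!^2] lets the dimension formula apply, and [(mn - p)! p!] turns the binomial
   coefficient into [(mn)!]. *)
apply: (mulfI (mulf_neq0 (mulf_neq0 a0 a0) (mulf_neq0 c0 a0))).
transitivity (x * y * (a * a) * fR * (a * c)); first by ring.
rewrite ew; transitivity (f1 * a * (f1 * v * c * fR)); first by ring.
rewrite e3 -cE; ring.
Qed.
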